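(* Let $v\in(1,\infty)$, $w\in(v,\infty]$ and $Q_0\subsetneqq\mathbb{R}^n$ be a cube. Then $\widehat{hk}_{v,w}(Q_0)=hk_{(v,w,0)_{0}}(Q_0)$ with equivalent norms, in the sense that the correspondence which sends a function $g=\sum_{i\in\mathbb{N}}\sum_{j\in\mathbb{N}}\lambda_{i,j}a_{i,j}$ in $L^v(Q_0)$ (a decomposition as in the definition of $\widehat{hk}_{v,w}(Q_0)$) to the functional $\widetilde g=\sum_{i\in\mathbb{N}}\sum_{j\in\mathbb{N}}\lambda_{i,j}a_{i,j}$ in $(jn_{(v',w',0)_0}(Q_0))^*$ is a well-defined (independent of the decompositions) bijection from $\widehat{hk}_{v,w}(Q_0)$ onto $hk_{(v,w,0)_0}(Q_0)$ under which the two norms are equivalent. Here $1/v+1/v'=1=1/w+1/w'$.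
   Context: $\mathbb{Z}_+=\{0,1,2,\dots\}$. A cube $Q\subset\mathbb{R}^n$ has edges parallel to the coordinate axes and finite positive side length $\ell(Q)$, and is not necessarily closed. Functions are complex-valued, measurable and identified when equal almost everywhere. $f_Q:=\fint_Q f:=\frac1{|Q|}\int_Q f$. Fix $c_0\in(0,\ell(Q_0))$ (the same constant in all definitions below). Let $P^{(0)}_{Q,c_0}(f):=f_Q$ if $\ell(Q)<c_0$ and $P^{(0)}_{Q,c_0}(f):=0$ if $\ell(Q)\ge c_0$. For $p\in(1,\infty)$, $q\in[1,\infty)$, $jn_{(p,q,0)_0}(Q_0)$ is the set of all $f\in L^q(Q_0)$ with $$\|f\|_{jn_{(p,q,0)_0}(Q_0)}:=\sup\Big[\sum_{j}|Q_j|\Big\{\Big[\fint_{Q_j}|f-P^{(0)}_{Q_j,c_0}(f)|^q\Big]^{1/q}\Big\}^p\Big]^{1/p}<\infty,$$ the supremum being over all countable (finite or infinite) collections $\{Q_j\}_j$ of cubes in $Q_0$ with pairwise disjoint interiors. Local atoms: a function $a$ on $\mathbb{R}^n$ is a local $(v,w,0)_0$-atom supported in a cube $Q$ if $\{a\ne0\}\subset Q$; $\|a\|_{L^w(Q)}\le|Q|^{\frac1w-\frac1v}$; and, when $\ell(Q)<c_0$, $\int_Q a=0$. An atom supported in a cube of $Q_0$ acts on $f\in jn_{(v',w',0)_0}(Q_0)$ by $f\mapsto\int_{Q}af$. The dual $(jn_{(v',w',0)_0}(Q_0))^*$ is equipped with the weak-$*$ topology. $\widetilde{hk}_{(v,w,0)_0}(Q_0)$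 is the set of all $g\in(jn_{(v',w',0)_0}(Q_0))^*$ of the form $g=\sum_j\lambda_ja_j$ (weak-$*$ convergence), where the $a_j$ are local $(v,w,0)_0$-atoms supported respectively in cubes $Q_j\subset Q_0$ with pairwise disjoint interiors (countably many), $\lambda_j\in\mathbb{C}$ and $\sum_j|\lambda_j|^v<\infty$; $\|g\|_{\widetilde{hk}_{(v,w,0)_0}(Q_0)}:=\inf(\sum_j|\lambda_j|^v)^{1/v}$ over all such decompositions. $hk_{(v,w,0)_0}(Q_0)$ is the set of all $g\in(jn_{(v',w',0)_0}(Q_0))^*$ such that $g=\sum_{i\in\mathbb{N}}g_i$ weak-$*$ with $g_i\in\widetilde{hk}_{(v,w,0)_0}(Q_0)$ and $\sum_i\|g_i\|_{\widetilde{hk}_{(v,w,0)_0}(Q_0)}<\infty$; its norm is $\inf\sum_i\|g_i\|_{\widetilde{hk}_{(v,w,0)_0}(Q_0)}$ over all such decompositions. $\widehat{hk}_{v,w}(Q_0)$ is the set of all $g\in L^v(Q_0)$ such that $g=\sum_{i\in\mathbb{N}}\sum_{j\in\mathbb{N}}\lambda_{i,j}a_{i,j}$ in $L^v(Q_0)$, where the $a_{i,j}$ are local $(v,w,0)_0$-atoms supported respectively in cubes $Q_{i,j}\subset Q_0$, for each $i$ the cubes $\{Q_{i,j}\}_j$ have pairwise disjoint interiors, $\lambda_{i,j}\in\mathbb{C}$ and $\sum_i(\sum_j|\lambda_{i,j}|^v)^{1/v}<\infty$; $\|g\|_{\widehat{hk}_{v,w}(Q_0)}:=\inf\sum_i(\sum_j|\lambda_{i,j}|^v)^{1/v}$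 over all such decompositions. *)

(* Defs.v *)
(* Functions on R^n or on Q_0 are plain functions Rn R n -> R[i]; spaces of
   functions are sets of such functions, "equal" means a.e. equal on Q_0, and
   values outside Q_0 of elements of L^q(Q_0) are irrelevant.  Every Lebesgue
   measurable function is a.e. equal to a Borel one, vanishing off a given Borel
   set if the original does, so Borel measurability gives the same a.e. classes. *)
From HB Require Import structures.
From mathcomp Require Import all_boot all_order all_algebra.
From mathcomp Require Import complex.
From mathcomp Require Import all_classical all_reals all_analysis.

Set Implicit Arguments.
Unset Strict Implicit.
Unset Printing Implicit Defensive.

Import Order.TTheory GRing.Theory Num.Theory.
Import numFieldNormedType.Exports.
Import Normc.

Local Open Scope classical_set_scope.
Local Open Scope ring_scope.

Notation Rn R n := (n.-tuple (measurableTypeR R)).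

(* n-dimensional Lebesgue measure is the image of lambda_1 \x lambda_n under
   (t, x) |-> t :: x, starting from the unit mass on the one-point space R^0.
   The sigma-finiteness proof is carried along since \x requires it. *)

Definition tuple_cons (R : realType) (n : nat)
    (p : measurableTypeR R * Rn R n) : Rn R n.+1 := [tuple of p.1 :: p.2].

Lemma measurable_tuple_cons (R : realType) (n : nat) :
  measurable_fun setT (@tuple_cons R n).
Proof. exact: measurable_cons. Qed.

Definition lebesgue_cons (R : realType) (n : nat)
    (mu : {sigma_finite_measure set (Rn R n) -> \bar R}) :
    set (Rn R n.+1) -> \bar R :=
  pushforward (@lebesgue_measure R \x mu)%E (@tuple_cons R n).

Definition tuple_uncons (R : realType) (n : nat) (x : Rn R n.+1) :
  measurableTypeR R * Rn R n := (thead x, [tuple of behead x]).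

Lemma measurable_tuple_uncons (R : realType) (n : nat) :
  measurable_fun setT (@tuple_uncons R n).
Proof.
apply/measurable_fun_pairP; split.
  exact: measurable_tnth.
exact: measurable_behead.
Qed.

Lemma tuple_consK (R : realType) (n : nat) :
  cancel (@tuple_cons R n) (@tuple_uncons R n).
Proof.
move=> [t x]; rewrite /tuple_uncons /tuple_cons theadE; congr pair.
exact: val_inj.
Qed.

Section lebesgue_cons.
Context (R : realType) (n : nat)
  (mu : {sigma_finite_measure set (Rn R n) -> \bar R}).

Let lebesgue_cons0 : lebesgue_cons mu set0 = 0%E.
Proof. by rewrite /lebesgue_cons /pushforward preimage_set0 measure0. Qed.

Let lebesgue_cons_ge0 A : (0 <= lebesgue_cons mu A)%E.
Proof. by rewrite /lebesgue_cons /pushforward measure_ge0. Qed.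

Let lebesgue_cons_semi_sigma_additive : semi_sigma_additive (lebesgue_cons mu).
Proof.
move=> F mF tF mUF; rewrite /lebesgue_cons /pushforward preimage_bigcup.
have mpre A : measurable A -> measurable (@tuple_cons R n @^-1` A).
  by move=> mA; rewrite -[X in measurable X]setTI; exact: measurable_tuple_cons.
apply: measure_semi_sigma_additive.
- by move=> k; exact: mpre.
- apply/trivIsetP => /= i j _ _ ij; rewrite -preimage_setI.
  by move/trivIsetP : tF => /(_ _ _ _ _ ij) ->//; rewrite preimage_set0.
- by rewrite -preimage_bigcup; exact: mpre.
Qed.

HB.instance Definition _ := isMeasure.Build _ _ _ (lebesgue_cons mu)
  lebesgue_cons0 lebesgue_cons_ge0 lebesgue_cons_semi_sigma_additive.

Let lebesgue_cons_sigma_finite : sigma_finite setT (lebesgue_cons mu).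
Proof.
have /sigma_finiteP[F [TF ndF Foo]] := sigma_finiteT (@lebesgue_measure R).
have /sigma_finiteP[G [TG ndG Goo]] := sigma_finiteT mu.
exists (fun k => @tuple_uncons R n @^-1` (F k `*` G k)).
  rewrite -preimage_bigcup (_ : \bigcup_k _ = setT) ?preimage_setT//.
  rewrite -setXTT TF TG predeqE => -[x y]; split.
    by move=> [n0 _ []/= ? ?]; split; exists n0.
  move=> [/= [k _ Fkx] [l _ Gly]]; exists (maxn k l) => //; split.
  - by move: x Fkx; exact/subsetPset/ndF/leq_maxl.
  - by move: y Gly; exact/subsetPset/ndG/leq_maxr.
move=> k; have [mF Fk] := Foo k; have [mG Gk] := Goo k; split.
  rewrite -[X in measurable X]setTI; apply: measurable_tuple_uncons => //.
  exact: measurableX.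
rewrite /lebesgue_cons /pushforward -comp_preimage.
rewrite (_ : _ \o _ = id); last by apply/funext => p; exact: tuple_consK.
by rewrite preimage_id product_measure1E// lte_mul_pinfty// ge0_fin_numE.
Qed.

HB.instance Definition _ := Measure_isSigmaFinite.Build _ _ _
  (lebesgue_cons mu) lebesgue_cons_sigma_finite.

End lebesgue_cons.

Fixpoint lebesgue (R : realType) (n : nat) :
    {sigma_finite_measure set (Rn R n) -> \bar R} :=
  match n with
  | 0 => @dirac _ (Rn R 0) [tuple] R
  | n'.+1 => lebesgue_cons (lebesgue R n')
  end.

(* Cubes.  [lbnd i] and [rbnd i] tell which endpoints of the i-th edge are
   included (BSide true is a closed left end, BSide false a closed right end),
   so open, closed and half-open cubes are all covered. *)

Record cube (R : realType) (n : nat) := Cube {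
  corner : Rn R n ;
  side : R ;
  lbnd : 'I_n -> bool ;
  rbnd : 'I_n -> bool ;
  side_gt0 : 0 < side }.

Section cubes.
Context {R : realType} {n : nat}.
Implicit Types Q : cube R n.

Definition cset Q : set (Rn R n) :=
  [set x | forall i : 'I_n, (tnth x i : R) \in
     Interval (BSide (lbnd Q i) (tnth (corner Q) i : R))
              (BSide (rbnd Q i) ((tnth (corner Q) i : R) + side Q))].

Definition cinterior Q : set (Rn R n) :=
  [set x | forall i : 'I_n, (tnth x i : R) \in
     `](tnth (corner Q) i : R), ((tnth (corner Q) i : R) + side Q)[].

Definition vol Q : R := fine (lebesgue R n (cset Q)).

(* A countable (finite or infinite) collection of cubes in Q0 with pairwise
   disjoint interiors is a family indexed by a set J of naturals. *)
Definition packing (Q0 : cube R n) (J : set nat) (Q : nat -> cube R n) : Prop :=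
  (forall j, J j -> cset (Q j) `<=` cset Q0) /\
  trivIset J (fun j => cinterior (Q j)).

End cubes.

Lemma lebesgue_box (R : realType) (n : nat) (I : 'I_n -> interval R) :
  measurable ([set x : Rn R n | forall i, (tnth x i : R) \in I i]) /\
  lebesgue R n [set x : Rn R n | forall i, (tnth x i : R) \in I i] =
  (\prod_(i < n) lebesgue_measure [set` I i])%E.
Proof.
have mbox m (J : 'I_m -> interval R) :
    measurable ([set x : Rn R m | forall i, (tnth x i : R) \in J i]).
  rewrite (_ : mkset _ = \bigcap_(i : 'I_m)
     ((fun x : Rn R m => tnth x i) @^-1` [set` J i])); last first.
    by apply/seteqP; split => x /= h i; [move=> _|]; exact: h.
  apply: fin_bigcap_measurable => [|i _]; first exact: finite_finset.
  rewrite -[X in measurable X]setTI.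
  exact: (@measurable_tnth _ (measurableTypeR R) m i measurableT
            [set` J i] (measurable_itv (J i))).
split; first exact: mbox.
elim: n I => [|n IH] I /=.
  by rewrite big_ord0 /dirac indicE mem_set// => -[].
rewrite big_ord_recl -IH.
have mI0 : measurable ([set` I ord0] : set (measurableTypeR R)).
  exact: (measurable_itv (I ord0)).
have := @product_measure1E _ _ _ _ R (@lebesgue_measure R) (lebesgue R n) _ _
  mI0 (mbox n (fun i => I (lift ord0 i))).
move=> <-; rewrite /lebesgue_cons /pushforward.
congr product_measure1; apply/seteqP; split => -[t x] /=.
  move=> h; split; first by have := h ord0; rewrite /tuple_cons /= tnth0.
  by move=> i; have := h (lift ord0 i); rewrite /tuple_cons /= tnthS.
move=> [ht hx] i; rewrite /tuple_cons/=.
case: (unliftP ord0 i) => [j ->|->]; last by rewrite tnth0.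
by rewrite tnthS; exact: hx.
Qed.

Lemma lebesgue_cube (R : realType) (n : nat) (Q : cube R n) :
  lebesgue R n (cset Q) = (side Q ^+ n)%:E.
Proof.
rewrite (lebesgue_box _).2.
rewrite (eq_bigr (fun=> (side Q)%:E)) => [|i _].
  by rewrite prodEFin prodr_const card_ord.
rewrite lebesgue_measure_itv/= lte_fin ltrDl side_gt0 -EFinB.
by rewrite addrAC subrr add0r.
Qed.

Section function_spaces.
Context {R : realType} {n : nat}.
Implicit Types (D : set (Rn R n)) (f g : Rn R n -> R[i]) (Q : cube R n).

Definition cmeasurable D f : Prop :=
  measurable_fun D (fun x => complex.Re (f x)) /\
  measurable_fun D (fun x => complex.Im (f x)).

Definition cint D f : R[i] :=
  Complex (\int[lebesgue R n]_(x in D) complex.Re (f x))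
          (\int[lebesgue R n]_(x in D) complex.Im (f x)).

Definition cLnorm D (p : \bar R) f : \bar R :=
  ('N[lebesgue R n]_p[(fun x => (normc (f x))%:E) \_ D])%E.

Definition Lspace D (p : \bar R) : set (Rn R n -> R[i]) :=
  [set f | cmeasurable D f /\ (cLnorm D p f < +oo)%E].

(* [Lsum D p u g]: the series of the u i converges to g in L^p(D) *)
Definition Lsum D (p : \bar R) (u : nat -> Rn R n -> R[i]) g : Prop :=
  (fun m => cLnorm D p (fun x => (\sum_(i < m) u i x) - g x)) @ \oo --> 0%E.

Definition cavg Q f : R[i] := real_complex R (vol Q)^-1 * cint (cset Q) f.

End function_spaces.

Section jn.
Context {R : realType} {n : nat}.
Variables (p q c0 : R) (Q0 : cube R n).
Implicit Types (f : Rn R n -> R[i]) (Q : cube R n).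

Definition P0 Q f : R[i] := if side Q < c0 then cavg Q f else 0.

Definition osc Q f : \bar R :=
  (((vol Q)^-1%:E *
    \int[lebesgue R n]_(x in cset Q) ((normc (f x - P0 Q f)) `^ q)%:E)
   `^ q^-1)%E.

Definition jn_norm f : \bar R :=
  ereal_sup [set y | exists (J : set nat) (Q : nat -> cube R n),
    packing Q0 J Q /\
    y = ((\esum_(j in J) ((vol (Q j))%:E * osc (Q j) f `^ p)) `^ p^-1)%E].

Definition jn : set (Rn R n -> R[i]) :=
  [set f | Lspace (cset Q0) q%:E f /\ (jn_norm f < +oo)%E].

End jn.

(* hoelder_conjugate is finite, hence unaffected by [fine], on (1, +oo]. *)
Definition conj_exp {R : realType} (p : \bar R) : R :=
  fine (hoelder_conjugate p).

(* Functionals on jn_{(v',w',0)_0}(Q0) are represented by functions defined on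
   all Rn R n -> R[i]; only their values on jn matter, and two of them are
   identified by [dual_eq].  Since jn_norm vanishes on functions that are a.e.
   zero on Q0, a bounded linear functional respects a.e. equality. *)
Section dual.
Context {R : realType} {n : nat}.
Variables (v : R) (w : \bar R) (c0 : R) (Q0 : cube R n).
Implicit Types phi psi : (Rn R n -> R[i]) -> R[i].

Definition jn' : set (Rn R n -> R[i]) :=
  jn (conj_exp v%:E) (conj_exp w) c0 Q0.

Definition jn'_norm (f : Rn R n -> R[i]) : \bar R :=
  jn_norm (conj_exp v%:E) (conj_exp w) c0 Q0 f.

Definition jn_dual : set ((Rn R n -> R[i]) -> R[i]) :=
  [set phi |
    (forall (k : R[i]) f g, jn' f -> jn' g ->
       phi (fun x => k * f x + g x) = k * phi f + phi g) /\
    (exists M : R, forall f, jn' f ->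
       ((normc (phi f))%:E <= M%:E * jn'_norm f)%E)].

Definition dual_eq phi psi : Prop := forall f, jn' f -> phi f = psi f.

Definition weak_star_sum (T : nat -> (Rn R n -> R[i]) -> R[i]) phi : Prop :=
  forall f, jn' f ->
    ((fun m => \sum_(j < m) T j f) : nat -> R[i]^o) @ \oo --> (phi f : R[i]^o).

End dual.

Section hardy_type.
Context {R : realType} {n : nat}.
Variables (v : R) (w : \bar R) (c0 : R) (Q0 : cube R n).
Implicit Types (a f g : Rn R n -> R[i]) (Q : cube R n).
Implicit Types (phi : (Rn R n -> R[i]) -> R[i]).

Definition atom Q a : Prop :=
  [/\ cmeasurable setT a,
      [set x | a x != 0] `<=` cset Q,
      (cLnorm (cset Q) w a <= ((vol Q) `^ (fine w^-1 - v^-1))%:E)%E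
    & side Q < c0 -> cint (cset Q) a = 0].

(* The data of a formal sum of lambda_j a_j over a countable family of cubes.
   Indices outside [idx s] carry no cube and no atom. *)
Record atom_series := AtomSeries {
  idx : set nat ;
  cubes_of : nat -> cube R n ;
  coef : nat -> R[i] ;
  atoms_of : nat -> Rn R n -> R[i] }.
Implicit Type s : atom_series.

Definition coef_norm s : \bar R :=
  ((\sum_(j <oo) ((normc (coef s j)) `^ v)%:E) `^ v^-1)%E.

Definition admissible s : Prop :=
  [/\ packing Q0 (idx s) (cubes_of s),
      (forall j, idx s j -> atom (cubes_of s j) (atoms_of s j)),
      (forall j, ~ idx s j -> coef s j = 0)
    & (coef_norm s < +oo)%E].

Definition fterm s (j : nat) : Rn R n -> R[i] :=
  fun x => coef s j * atoms_of s j x.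

Definition dterm s (j : nat) : (Rn R n -> R[i]) -> R[i] :=
  fun f => coef s j * cint (cset (cubes_of s j)) (fun x => atoms_of s j x * f x).

Definition hkt_decomp phi s : Prop :=
  admissible s /\ weak_star_sum v w c0 Q0 (dterm s) phi.

Definition hkt : set ((Rn R n -> R[i]) -> R[i]) :=
  [set phi | jn_dual v w c0 Q0 phi /\ exists s, hkt_decomp phi s].

Definition hkt_norm phi : \bar R :=
  ereal_inf [set coef_norm s | s in hkt_decomp phi].

Definition hk_decomp phi (T : nat -> (Rn R n -> R[i]) -> R[i]) : Prop :=
  [/\ forall i, hkt (T i),
      weak_star_sum v w c0 Q0 T phi
    & (\sum_(i <oo) hkt_norm (T i) < +oo)%E].

Definition hk : set ((Rn R n -> R[i]) -> R[i]) :=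
  [set phi | jn_dual v w c0 Q0 phi /\ exists T, hk_decomp phi T].

Definition hk_norm phi : \bar R :=
  ereal_inf [set (\sum_(i <oo) hkt_norm (T i))%E | T in hk_decomp phi].

(* g = sum_i (sum_j lambda_ij a_ij) as an iterated sum in L^v(Q0), with G i the
   inner sums. *)
Definition hkhat_decomp g (S : nat -> atom_series) : Prop :=
  [/\ forall i, admissible (S i),
      (\sum_(i <oo) coef_norm (S i) < +oo)%E
    & exists G : nat -> Rn R n -> R[i],
      [/\ forall i, Lspace (cset Q0) v%:E (G i),
          forall i, Lsum (cset Q0) v%:E (fterm (S i)) (G i)
        & Lsum (cset Q0) v%:E G g]].

Definition hkhat : set (Rn R n -> R[i]) :=
  [set g | Lspace (cset Q0) v%:E g /\ exists S, hkhat_decomp g S].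

Definition hkhat_norm g : \bar R :=
  ereal_inf [set (\sum_(i <oo) coef_norm (S i))%E | S in hkhat_decomp g].

(* phi = sum_i (sum_j lambda_ij a_ij) as an iterated weak-* sum in the dual of
   jn_{(v',w',0)_0}(Q0). *)
Definition dual_double_sum (S : nat -> atom_series) phi : Prop :=
  jn_dual v w c0 Q0 phi /\
  exists T : nat -> (Rn R n -> R[i]) -> R[i],
    [/\ forall i, jn_dual v w c0 Q0 (T i),
        forall i, weak_star_sum v w c0 Q0 (dterm (S i)) (T i)
      & weak_star_sum v w c0 Q0 T phi].

End hardy_type.

(* Main.v *)
(* An atom on Q pairs with f by at most 2 |Q|^(1/v') osc_Q f: on a small cube it
   has mean zero, so f may be replaced by f - P f.  This survives when f is
   replaced by its truncation f_N (real and imaginary parts clamped to [-N, N])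
   because clamping is 1-Lipschitz.  By Hoelder for sequences, the double series
   of the pairings int a_ij f_N is therefore dominated uniformly in N, and for
   bounded f_N it equals int g f_N.  Dominated convergence for series gives
     sum_i sum_j lambda_ij int a_ij f = lim_N int_{Q_0} g f_N,
   whose right-hand side does not involve the decomposition and is taken as the
   definition of the functional attached to g.  (The JN space is not contained
   in L^{v'}, hence the detour through truncations.)  Injectivity follows by
   testing on indicator functions.  Conversely, disjointness of the cubes in one
   packing bounds the L^v norm of the inner sums by a multiple of the l^v norm
   of the coefficients, so any weak-* decomposition also converges in L^v. *)
Require Import Defs.
From mathcomp Require Import all_boot all_order all_algebra.
From mathcomp Require Import complex lra.
From mathcomp Require Import all_classical all_reals all_analysis measurable_realfun ess_sup_inf.

Set Implicit Arguments.
Unset Strict Implicit.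
Unset Printing Implicit Defensive.

Import Order.TTheory GRing.Theory Num.Theory.
Import numFieldNormedType.Exports.

Local Open Scope classical_set_scope.
Local Open Scope ring_scope.

(* hoelder.v also declares an [Lspace], which would shadow the one of Defs.v. *)
Local Notation Lspace := Defs.Lspace.

(** * Limits of complex sequences *)

Section complex_limits.
Context {R : realType}.
Implicit Types (u : nat -> R[i]) (l z : R[i]) (b : nat -> R).

Lemma normcE z : `|z| = real_complex R (Normc.normc z).
Proof. by case: z. Qed.

Lemma normc_ge0 z : 0 <= Normc.normc z.
Proof. by case: z => a b; rewrite /= sqrtr_ge0. Qed.

Lemma normc_triangle (x y : R[i]) :
  Normc.normc (x + y) <= Normc.normc x + Normc.normc y.
Proof. exact: le_normcD. Qed.

Lemma normcBC (x y : R[i]) : Normc.normc (x - y) = Normc.normc (y - x).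
Proof. by rewrite -normcN opprB. Qed.

Lemma normc_sum (I : Type) (r : seq I) (P : pred I) (F : I -> R[i]) :
  Normc.normc (\sum_(i <- r | P i) F i) <= \sum_(i <- r | P i) Normc.normc (F i).
Proof.
elim/big_rec2 : _ => [|i x y _ h]; first by rewrite Normc.normc0.
by rewrite (le_trans (normc_triangle _ _))// lerD2l.
Qed.

Lemma ler_Re_normc z : `|complex.Re z| <= Normc.normc z.
Proof.
by case: z => a b /=; rewrite -sqrtr_sqr ler_sqrt ?addr_ge0 ?sqr_ge0// lerDl sqr_ge0.
Qed.

Lemma ler_Im_normc z : `|complex.Im z| <= Normc.normc z.
Proof.
by case: z => a b /=; rewrite -sqrtr_sqr ler_sqrt ?addr_ge0 ?sqr_ge0// lerDr sqr_ge0.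
Qed.

Lemma ler_normc_ReIm z :
  Normc.normc z <= `|complex.Re z| + `|complex.Im z|.
Proof.
case: z => a b /=; rewrite -(ger0_norm (addr_ge0 (normr_ge0 a) (normr_ge0 b))).
rewrite -sqrtr_sqr ler_sqrt ?sqr_ge0// sqrrD !real_normK ?num_real//.
by rewrite -addrA lerD2l lerDr mulrn_wge0// mulr_ge0.
Qed.

Lemma cReD (x y : R[i]) : complex.Re (x + y) = complex.Re x + complex.Re y.
Proof. by case: x => ? ?; case: y. Qed.

Lemma cImD (x y : R[i]) : complex.Im (x + y) = complex.Im x + complex.Im y.
Proof. by case: x => ? ?; case: y. Qed.

Lemma cReN (x : R[i]) : complex.Re (- x) = - complex.Re x.
Proof. by case: x. Qed.

Lemma cImN (x : R[i]) : complex.Im (- x) = - complex.Im x.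
Proof. by case: x. Qed.

Lemma cReM (x y : R[i]) : complex.Re (x * y) =
  complex.Re x * complex.Re y - complex.Im x * complex.Im y.
Proof. by case: x => ? ?; case: y. Qed.

Lemma cImM (x y : R[i]) : complex.Im (x * y) =
  complex.Re x * complex.Im y + complex.Im x * complex.Re y.
Proof. by case: x => ? ?; case: y. Qed.

Lemma cRe_sum (I : Type) (r : seq I) (P : pred I) (F : I -> R[i]) :
  complex.Re (\sum_(i <- r | P i) F i) = \sum_(i <- r | P i) complex.Re (F i).
Proof. exact: (big_morph _ cReD). Qed.

Lemma cIm_sum (I : Type) (r : seq I) (P : pred I) (F : I -> R[i]) :
  complex.Im (\sum_(i <- r | P i) F i) = \sum_(i <- r | P i) complex.Im (F i).
Proof. exact: (big_morph _ cImD). Qed.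

Definition ccvg u l : Prop := forall e : R, 0 < e ->
  exists N, forall m, (N <= m)%N -> Normc.normc (u m - l) < e.

Lemma ccvgP u l : ((u : nat -> R[i]^o) @ \oo --> (l : R[i]^o)) <-> ccvg u l.
Proof.
split=> [ul e e0|ul].
  have e0' : 0 < real_complex R e by rewrite ltcR.
  have [N _ h] := cvgr_distC_lt _ _ ul _ e0'.
  by exists N => m Nm; have := h m Nm; rewrite /= normcE ltcR.
apply/cvgrPdistC_lt => -[e e'] /=; rewrite ltcE /= => /andP[/eqP -> e0].
have [N h] := ul _ e0; exists N => // m Nm.
by rewrite /= normcE ltcR; exact: h.
Qed.

Lemma ccvg_unique u l l' : ccvg u l -> ccvg u l' -> l = l'.
Proof.
move=> ul ul'; apply/eqP; rewrite -subr_eq0; apply/eqP/Normc.eq0_normc.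
apply/eqP; rewrite eq_le normc_ge0 andbT; apply/ler_addgt0Pr => e e0.
rewrite add0r.
have e2 : 0 < e / 2 by rewrite divr_gt0.
have [N h] := ul _ e2; have [N' h'] := ul' _ e2.
have := h _ (leq_maxl N N'); have := h' _ (leq_maxr N N').
set m := maxn N N' => h1 h2.
have -> : l - l' = (l - u m) + (u m - l') by rewrite addrA subrK.
rewrite (le_trans (normc_triangle _ _))// [e]splitr normcBC.
by rewrite lerD// ltW.
Qed.

Lemma eq_ccvg u u' l : u =1 u' -> ccvg u l -> ccvg u' l.
Proof. by move=> uu' ul e /ul[N h]; exists N => m /h; rewrite uu'. Qed.

Lemma ccvg_cst l : ccvg (fun=> l) l.
Proof. by move=> e e0; exists 0%N => m _; rewrite subrr Normc.normc0. Qed.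

Lemma ccvgD u u' l l' : ccvg u l -> ccvg u' l' ->
  ccvg (fun m => u m + u' m) (l + l').
Proof.
move=> ul ul' e e0; have e2 : 0 < e / 2 by rewrite divr_gt0.
have [N h] := ul _ e2; have [N' h'] := ul' _ e2.
exists (maxn N N') => m; rewrite geq_max => /andP[Nm N'm].
rewrite opprD addrACA (le_lt_trans (normc_triangle _ _))// [e]splitr.
by rewrite ltrD ?h ?h'.
Qed.

Lemma ccvgZ k u l : ccvg u l -> ccvg (fun m => k * u m) (k * l).
Proof.
by move=> /ccvgP ul; apply/ccvgP; exact: (cvgM (cvg_cst (k : R[i]^o)) ul).
Qed.

Lemma ccvg_sum m (u : nat -> nat -> R[i]) (l : nat -> R[i]) :
  (forall i, ccvg (u ^~ i) (l i)) ->
  ccvg (fun N => \sum_(i < m) u N i) (\sum_(i < m) l i).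
Proof.
move=> ul; elim: m => [|m ih].
  by apply: (@eq_ccvg (fun=> 0)) => [N|]; rewrite big_ord0//; exact: ccvg_cst.
rewrite big_ord_recr/=.
by apply: (@eq_ccvg _ _ _ _ (ccvgD ih (ul m))) => N; rewrite big_ord_recr.
Qed.

Lemma ccvg_norm_le u l (K : R) :
  (exists N, forall m, (N <= m)%N -> Normc.normc (u m) <= K) -> ccvg u l ->
  Normc.normc l <= K.
Proof.
move=> [N' uK] ul; apply/ler_addgt0Pr => e e0; have [N h] := ul _ e0.
set m := maxn N N'.
have -> : l = u m + (l - u m) by rewrite addrCA subrr addr0.
rewrite (le_trans (normc_triangle _ _))// lerD ?uK ?leq_maxr//.
by rewrite normcBC ltW// h// leq_maxl.
Qed.

Definition clim u : R[i] := xget 0 [set l | ccvg u l].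

Lemma climE u l : ccvg u l -> clim u = l.
Proof.
move=> ul; apply: ccvg_unique (ul).
exact: (@xgetPex _ _ [set l | ccvg u l] (ex_intro _ l ul)).
Qed.

Lemma ccvg_ReIm u (a b : R) : (fun m => complex.Re (u m)) @ \oo --> a ->
  (fun m => complex.Im (u m)) @ \oo --> b -> ccvg u (Complex a b).
Proof.
move=> ua ub e e0; have e2 : 0 < e / 2 by rewrite divr_gt0.
have [N _ h] := cvgr_distC_lt _ _ ua _ e2; have [N' _ h'] := cvgr_distC_lt _ _ ub _ e2.
exists (maxn N N') => m; rewrite geq_max => /andP[Nm N'm].
rewrite (le_lt_trans (ler_normc_ReIm _))// cReD cReN cImD cImN/= [e]splitr.
by rewrite ltrD//; [exact: h|exact: h'].
Qed.

Lemma real_abs_series_cvg (a : nat -> R) (K : R) :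
  (forall m, \sum_(i < m) `|a i| <= K) ->
  exists x : R, (fun m => \sum_(i < m) a i) @ \oo --> x.
Proof.
move=> aK.
have h : cvgn [normed series a].
  apply: nondecreasing_is_cvgn.
    apply/nondecreasing_seqP => k.
    by rewrite /= [X in _ <= X]seriesSr lerDl.
  by exists K => _ [k _ <-]; rewrite /= seriesEord; exact: aK.
have /cvg_ex[x al] := normed_cvg h.
exists x; move: al; apply: cvg_trans; apply: near_eq_cvg.
by apply: nearW => m; rewrite seriesEord.
Qed.

Lemma abs_series_ccvg u (K : R) : (forall m, \sum_(i < m) Normc.normc (u i) <= K) ->
  exists2 l, ccvg (fun m => \sum_(i < m) u i) l & Normc.normc l <= K.
Proof.
move=> uK.
have [a ua] : exists a : R, (fun m => \sum_(i < m) complex.Re (u i)) @ \oo --> a.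
  apply: (@real_abs_series_cvg (fun i => complex.Re (u i)) K) => m.
  by apply: le_trans (uK m); apply: ler_sum => i _; exact: ler_Re_normc.
have [b ub] : exists b : R, (fun m => \sum_(i < m) complex.Im (u i)) @ \oo --> b.
  apply: (@real_abs_series_cvg (fun i => complex.Im (u i)) K) => m.
  by apply: le_trans (uK m); apply: ler_sum => i _; exact: ler_Im_normc.
have ul : ccvg (fun m => \sum_(i < m) u i) (Complex a b).
  apply: ccvg_ReIm.
    by under eq_fun do rewrite cRe_sum; exact: ua.
  by under eq_fun do rewrite cIm_sum; exact: ub.
exists (Complex a b) => //; apply: ccvg_norm_le (ul); exists 0%N => m _.
by apply: le_trans (uK m); exact: normc_sum.
Qed.

Lemma bounded_series_tail b (K e : R) : (forall i, 0 <= b i) ->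
  (forall m, \sum_(i < m) b i <= K) -> 0 < e ->
  exists m0, forall m, \sum_(m0 <= i < m) b i < e.
Proof.
move=> b0 bK e0; pose E : set R := range (fun m => \sum_(i < m) b i).
have hE : has_sup E.
  by split; [exists 0; exists 0%N => //; rewrite big_ord0|exists K => _ [m _ <-]].
have [_ [m0 _ <-] h] := sup_adherent e0 hE.
exists m0 => m; have [m0m|mm0] := leqP m0 m; last by rewrite big_geq// ltnW.
have : \sum_(i < m) b i <= sup E by apply: ub_le_sup; [case: hE|exists m].
rewrite -(big_mkord xpredT b) (big_cat_nat (leq0n m0) m0m)//= big_mkord => h2.
by rewrite -(ltrD2l (\sum_(i < m0) b i)); apply: le_lt_trans h2 _; rewrite -ltrBlDr.
Qed.

(* Tannery's theorem. *)
Lemma series_dominated_ccvg (u : nat -> nat -> R[i]) (l A : nat -> R[i]) L b (K : R) :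
  (forall N i, Normc.normc (u N i) <= b i) -> (forall m, \sum_(i < m) b i <= K) ->
  (forall i, ccvg (u ^~ i) (l i)) ->
  (forall N, ccvg (fun m => \sum_(i < m) u N i) (A N)) ->
  ccvg (fun m => \sum_(i < m) l i) L ->
  ccvg A L.
Proof.
move=> ub bK ul uA lL e e0.
have b0 i : 0 <= b i by apply: le_trans (normc_ge0 _) (ub 0 i).
have lb i : Normc.normc (l i) <= b i.
  by apply: ccvg_norm_le (ul i); exists 0%N => N _; exact: ub.
have e3 : 0 < e / 3 by rewrite divr_gt0.
have [m0 hm0] := bounded_series_tail b0 bK e3.
have tail (x : nat -> R[i]) X : (forall i, Normc.normc (x i) <= b i) ->
    ccvg (fun m => \sum_(i < m) x i) X ->
    Normc.normc (X - \sum_(i < m0) x i) <= e / 3.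
  move=> xb xX; apply: ccvg_norm_le (ccvgD xX (ccvg_cst _)).
  exists m0 => m m0m; rewrite -(big_mkord xpredT x) (big_cat_nat (leq0n m0) m0m)//=.
  rewrite big_mkord addrAC subrr add0r (le_trans (normc_sum _ _ _))//.
  by apply: le_trans (ltW (hm0 m)); apply: ler_sum => i _.
have [N hN] := ccvg_sum m0 ul e3.
exists N => k /hN; set a := \sum_(i < m0) u k i; set c := \sum_(i < m0) l i => h.
have -> : A k - L = ((A k - a) + (a - c)) + (c - L).
  by rewrite [_ + (a - c)]addrA subrK addrA subrK.
have h1 := tail _ _ (ub k) (uA k); have h2 := tail _ _ lb lL.
have -> : e = e / 3 + e / 3 + e / 3 by lra.
rewrite (le_lt_trans (normc_triangle _ _))// ltr_leD//; last by rewrite normcBC.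
by rewrite (le_lt_trans (normc_triangle _ _))// ler_ltD.
Qed.

End complex_limits.

(** * Integrals of complex functions *)

Section complex_integral.
Context {R : realType} {n : nat}.
Implicit Types (D E : set (Rn R n)) (f g h : Rn R n -> R[i]).
Local Notation mu := (lebesgue R n).
Local Notation normc := (@Normc.normc R).

Lemma eq_cmeasurable D f g : (forall x, D x -> f x = g x) ->
  cmeasurable D f -> cmeasurable D g.
Proof.
move=> fg [mr mi]; split.
  by apply: eq_measurable_fun mr => x /set_mem Dx; rewrite fg.
by apply: eq_measurable_fun mi => x /set_mem Dx; rewrite fg.
Qed.

Lemma cmeasurableS D E f : measurable E -> D `<=` E -> cmeasurable E f ->
  cmeasurable D f.
Proof.
by move=> mE DE [mr mi]; split; [exact: measurable_funS mr|exact: measurable_funS mi].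
Qed.

Lemma cmeasurable_cst D z : cmeasurable D (fun=> z).
Proof. by split; exact: measurable_cst. Qed.

Lemma cmeasurableD D f g : cmeasurable D f -> cmeasurable D g ->
  cmeasurable D (fun x => f x + g x).
Proof.
move=> [fr fi] [gr gi]; split.
  by under eq_fun do rewrite cReD; exact: measurable_funD.
by under eq_fun do rewrite cImD; exact: measurable_funD.
Qed.

Lemma cmeasurableM D f g : cmeasurable D f -> cmeasurable D g ->
  cmeasurable D (fun x => f x * g x).
Proof.
move=> [fr fi] [gr gi]; split.
  under eq_fun do rewrite cReM.
  by apply: measurable_funB; exact: measurable_funM.
under eq_fun do rewrite cImM.
by apply: measurable_funD; exact: measurable_funM.
Qed.

Lemma cmeasurableZ D z f : cmeasurable D f -> cmeasurable D (fun x => z * f x).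
Proof. by apply: cmeasurableM; exact: cmeasurable_cst. Qed.

Lemma cmeasurableB D f g : cmeasurable D f -> cmeasurable D g ->
  cmeasurable D (fun x => f x - g x).
Proof.
move=> mf mg; apply: cmeasurableD => //.
by apply: (eq_cmeasurable _ (cmeasurableZ (-1) mg)) => x _; rewrite mulN1r.
Qed.

Lemma cmeasurable_sum D (I : Type) (r : seq I) (F : I -> Rn R n -> R[i]) :
  (forall i, cmeasurable D (F i)) -> cmeasurable D (fun x => \sum_(i <- r) F i x).
Proof.
move=> mF; elim: r => [|i r ih].
  by apply: (eq_cmeasurable _ (cmeasurable_cst D 0)) => x _; rewrite big_nil.
by apply: (eq_cmeasurable _ (cmeasurableD (mF i) ih)) => x _; rewrite big_cons.
Qed.

Lemma measurable_normc D f : cmeasurable D f ->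
  measurable_fun D (fun x => normc (f x)).
Proof.
move=> [fr fi].
have -> : (fun x => normc (f x)) = (fun x =>
    Num.sqrt (complex.Re (f x) ^+ 2 + complex.Im (f x) ^+ 2)).
  by apply/funext => x; case: (f x).
apply: (@measurableT_comp _ _ _ _ _ _ (@Num.sqrt R)).
  by apply: continuous_measurable_fun; apply: sqrt_continuous.
by apply: measurable_funD; exact: measurable_funX.
Qed.

Lemma measurable_normcE D f : cmeasurable D f ->
  measurable_fun D (fun x => (normc (f x))%:E).
Proof. by move=> mf; apply/measurable_EFinP; exact: measurable_normc. Qed.

Definition cintegrable D f : Prop :=
  cmeasurable D f /\ (\int[mu]_(x in D) (normc (f x))%:E < +oo)%E.

Lemma le_cintegrable D f g : measurable D -> cmeasurable D f ->
  (forall x, D x -> normc (f x) <= normc (g x)) -> cintegrable D g ->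
  cintegrable D f.
Proof.
move=> mD mf fg [mg ig]; split => //; apply: le_lt_trans ig.
apply: ge0_le_integral => //.
- by move=> x _; rewrite lee_fin normc_ge0.
- exact: measurable_normcE.
- exact: measurable_normcE.
Qed.

Lemma cintegrable_norm D f : measurable D -> cintegrable D f ->
  mu.-integrable D (fun x => (normc (f x))%:E).
Proof.
move=> mD [mf ifin]; apply/integrableP; split; first exact: measurable_normcE.
by under eq_integral do rewrite gee0_abs ?lee_fin ?normc_ge0//.
Qed.

Lemma cintegrable_Re D f : measurable D -> cintegrable D f ->
  mu.-integrable D (EFin \o (fun x => complex.Re (f x))).
Proof.
move=> mD [mf ifin]; apply: le_integrable (cintegrable_norm mD (conj mf ifin)) => //.
  by apply/measurable_EFinP; case: mf.
by move=> x _ /=; rewrite lee_fin (ger0_norm (normc_ge0 _)) ler_Re_normc.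
Qed.

Lemma cintegrable_Im D f : measurable D -> cintegrable D f ->
  mu.-integrable D (EFin \o (fun x => complex.Im (f x))).
Proof.
move=> mD [mf ifin]; apply: le_integrable (cintegrable_norm mD (conj mf ifin)) => //.
  by apply/measurable_EFinP; case: mf.
by move=> x _ /=; rewrite lee_fin (ger0_norm (normc_ge0 _)) ler_Im_normc.
Qed.

Lemma cintegrableD D f g : measurable D -> cintegrable D f -> cintegrable D g ->
  cintegrable D (fun x => f x + g x).
Proof.
move=> mD [mf fi] [mg gi]; split; first exact: cmeasurableD.
apply: (@le_lt_trans _ _ (\int[mu]_(x in D) ((normc (f x))%:E + (normc (g x))%:E))%E).
  apply: ge0_le_integral => //.
  - by move=> x _; rewrite lee_fin normc_ge0.
  - by apply: measurable_normcE; exact: cmeasurableD.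
  - by apply: emeasurable_funD; exact: measurable_normcE.
  - by move=> x _; rewrite -EFinD lee_fin normc_triangle.
rewrite ge0_integralD//; first exact: lte_add_pinfty.
- by move=> x _; rewrite lee_fin normc_ge0.
- exact: measurable_normcE.
- by move=> x _; rewrite lee_fin normc_ge0.
- exact: measurable_normcE.
Qed.

Lemma integral_normcZ D z f : measurable D -> cmeasurable D f ->
  (\int[mu]_(x in D) (normc (z * f x))%:E =
   (normc z)%:E * \int[mu]_(x in D) (normc (f x))%:E)%E.
Proof.
move=> mD mf; under eq_integral do rewrite Normc.normcM EFinM.
rewrite ge0_integralZl_EFin ?normc_ge0//; last exact: measurable_normcE.
by move=> x _; rewrite lee_fin normc_ge0.
Qed.

Lemma cintegrableZ D z f : measurable D -> cintegrable D f ->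
  cintegrable D (fun x => z * f x).
Proof.
move=> mD [mf fi]; split; first exact: cmeasurableZ.
by rewrite integral_normcZ// lte_mul_pinfty// lee_fin normc_ge0.
Qed.

Lemma eq_cint D f g : (forall x, D x -> f x = g x) -> cint D f = cint D g.
Proof.
by move=> fg; congr Complex; apply: eq_Rintegral => x /set_mem Dx; rewrite fg.
Qed.

Lemma cintD D f g : measurable D -> cintegrable D f -> cintegrable D g ->
  cint D (fun x => f x + g x) = cint D f + cint D g.
Proof.
move=> mD fi gi; rewrite /cint; apply/eqP; rewrite eq_complex/=.
under eq_Rintegral do rewrite cReD; under [X in _ && (X == _)]eq_Rintegral do rewrite cImD.
rewrite !RintegralD ?eqxx//; by [exact: cintegrable_Re|exact: cintegrable_Im].
Qed.

Lemma cintZ D z f : measurable D -> cintegrable D f ->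
  cint D (fun x => z * f x) = z * cint D f.
Proof.
move=> mD fi; have fr := cintegrable_Re mD fi; have fI := cintegrable_Im mD fi.
have iZ k (F : Rn R n -> R) : mu.-integrable D (EFin \o F) ->
    mu.-integrable D (EFin \o (fun x => k * F x)).
  by move=> iF; exact: (integrableZl mD k iF).
case: z => a b; rewrite /cint; apply/eqP; rewrite eq_complex/=.
under eq_Rintegral do rewrite cReM.
under [X in _ && (X == _)]eq_Rintegral do rewrite cImM.
rewrite RintegralB ?RintegralD//=; try exact: iZ.
by rewrite !RintegralZl// !eqxx.
Qed.

Lemma cintB D f g : measurable D -> cintegrable D f -> cintegrable D g ->
  cint D (fun x => f x - g x) = cint D f - cint D g.
Proof.
move=> mD fi gi; have := cintegrableZ (-1) mD gi => gi'.
transitivity (cint D (fun x => f x + -1 * g x)).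
  by apply: eq_cint => x _; rewrite mulN1r.
by rewrite cintD// cintZ// mulN1r.
Qed.

Lemma cint_sum D m (F : nat -> Rn R n -> R[i]) : measurable D ->
  (forall i, cintegrable D (F i)) ->
  cintegrable D (fun x => \sum_(i < m) F i x) /\
  cint D (fun x => \sum_(i < m) F i x) = \sum_(i < m) cint D (F i).
Proof.
move=> mD iF; elim: m => [|m [ih1 ih2]].
  split.
    split; first by apply: cmeasurable_sum => i; case: (iF i).
    by under eq_integral do rewrite big_ord0 Normc.normc0; rewrite integral0 ltry.
  rewrite big_ord0 /cint; apply/eqP; rewrite eq_complex/=.
  under eq_Rintegral do rewrite big_ord0.
  under [X in _ && (X == _)]eq_Rintegral do rewrite big_ord0.
  by rewrite /Rintegral/= !integral0 /= eqxx.
have e x : \sum_(i < m.+1) F i x = (\sum_(i < m) F i x) + F m x.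
  by rewrite big_ord_recr.
split; first by under eq_fun do rewrite e; exact: cintegrableD.
by under eq_fun do rewrite e; rewrite cintD// ih2 big_ord_recr.
Qed.

Lemma normc_cint_le D f : measurable D -> cintegrable D f ->
  ((normc (cint D f))%:E <= 2%:E * \int[mu]_(x in D) (normc (f x))%:E)%E.
Proof.
move=> mD fi; have iN := cintegrable_norm mD fi.
have h (F : Rn R n -> R) : mu.-integrable D (EFin \o F) ->
    (forall x, `|F x| <= normc (f x)) ->
    (`| \int[mu]_(x in D) F x |%:E <= \int[mu]_(x in D) (normc (f x))%:E)%E.
  move=> iF Ff.
  have -> : (\int[mu]_(x in D) (normc (f x))%:E =
             (\int[mu]_(x in D) (normc (f x)))%:E)%E.
    by rewrite /Rintegral fineK// integrable_fin_num.
  rewrite lee_fin (le_trans (le_normr_Rintegral mD iF))//.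
  by apply: le_Rintegral => //; apply/integrable_abse: iF.
rewrite (@le_trans _ _ ((`|complex.Re (cint D f)| + `|complex.Im (cint D f)|)%:E))//.
  by rewrite lee_fin ler_normc_ReIm.
rewrite -[2%R]/(1 + 1 : R)%R !EFinD muleDl//; last exact: integrable_fin_num.
rewrite !mul1e.
apply: leeD; apply: h.
- exact: cintegrable_Re.
- by move=> x; exact: ler_Re_normc.
- exact: cintegrable_Im.
- by move=> x; exact: ler_Im_normc.
Qed.

Lemma ae_eq_cint D f g : measurable D -> cmeasurable D f -> cmeasurable D g ->
  f = g %[ae mu in D] -> cint D f = cint D g.
Proof.
move=> mD [fr fi] [gr gi] fg; rewrite /cint /Rintegral; congr Complex; congr fine.
  apply: ae_eq_integral => //; [exact/measurable_EFinP|exact/measurable_EFinP|].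
  by apply: filterS fg => x h /h ->.
apply: ae_eq_integral => //; [exact/measurable_EFinP|exact/measurable_EFinP|].
by apply: filterS fg => x h /h ->.
Qed.

End complex_integral.

(** * Cubes *)

Section cubes_theory.
Context {R : realType} {n : nat}.
Implicit Types (Q : cube R n).
Local Notation mu := (lebesgue R n).

Lemma measurable_cset Q : measurable (cset Q).
Proof. exact: (lebesgue_box _).1. Qed.

Lemma measurable_cinterior Q : measurable (cinterior Q).
Proof. exact: (lebesgue_box _).1. Qed.

Lemma cinterior_sub Q : cinterior Q `<=` cset Q.
Proof.
move=> x h i; have := h i; rewrite !in_itv/= => /andP[h1 h2].
by case: lbnd; case: rbnd; rewrite /= ?h1 ?h2 ?(ltW h1) ?(ltW h2).
Qed.

Lemma volE Q : vol Q = side Q ^+ n.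
Proof. by rewrite /vol lebesgue_cube. Qed.

Lemma vol_gt0 Q : 0 < vol Q.
Proof. by rewrite volE exprn_gt0// side_gt0. Qed.

Lemma lebesgue_cset Q : mu (cset Q) = (vol Q)%:E.
Proof. by rewrite volE lebesgue_cube. Qed.

Lemma lebesgue_cset_gt0 Q : (0 < mu (cset Q))%E.
Proof. by rewrite lebesgue_cset lte_fin vol_gt0. Qed.

Lemma lebesgue_cinterior Q : mu (cinterior Q) = (vol Q)%:E.
Proof.
rewrite (lebesgue_box _).2 volE.
rewrite (eq_bigr (fun=> (side Q)%:E)) => [|i _].
  by rewrite prodEFin prodr_const card_ord.
rewrite lebesgue_measure_itv/= lte_fin ltrDl side_gt0 -EFinB.
by rewrite addrAC subrr add0r.
Qed.

Lemma negligible_boundary Q : mu.-negligible (cset Q `\` cinterior Q).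
Proof.
apply/negligibleP.
  by apply: measurableD; [exact: measurable_cset|exact: measurable_cinterior].
have sub : cset Q `&` cinterior Q = cinterior Q.
  by apply/setIidPr; exact: cinterior_sub.
rewrite measureD.
- rewrite sub [X in (X - _)%E](lebesgue_cset Q : _ = (vol Q)%:E).
  by rewrite [X in (_ - X)%E](lebesgue_cinterior Q : _ = (vol Q)%:E) subee.
- exact: measurable_cset.
- exact: measurable_cinterior.
- by rewrite [X in (X < _)%E](lebesgue_cset Q : _ = (vol Q)%:E) ltry.
Qed.

Lemma ae_packing_disjoint (Q0 : cube R n) J (Q : nat -> cube R n) : packing Q0 J Q ->
  {ae mu, forall x, forall i j, J i -> J j -> cset (Q i) x -> cset (Q j) x -> i = j}.
Proof.
move=> [_ /trivIsetP tI].
have : mu.-negligible (\bigcup_k (cset (Q k) `\` cinterior (Q k))).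
  by apply: negligible_bigcup => k; exact: negligible_boundary.
apply: negligibleS => x /= h; apply: contrapT => nb; apply: h => i j Ji Jj Qi Qj.
have int k : cset (Q k) x -> cinterior (Q k) x.
  by move=> Qk; apply: contrapT => nQk; apply: nb; exists k.
apply: contrapT => ij.
have := tI i j Ji Jj; move/eqP: ij => ij /(_ ij) /eqP.
by apply/negP/set0P; exists x; split; exact: int.
Qed.

End cubes_theory.

(** * Hoelder's inequality and Lebesgue spaces *)

Section Lnorm_theory.
Context {R : realType} {n : nat}.
Implicit Types (D : set (Rn R n)) (f g : Rn R n -> R[i]) (p q M : R).
Local Notation mu := (lebesgue R n).
Local Notation normc := (@Normc.normc R).

Lemma restrict_EFin D (F : Rn R n -> R) :
  (fun x => (F x)%:E) \_ D = EFin \o (F \_ D).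
Proof. by apply/funext => x; rewrite /= !patchE; case: ifPn. Qed.

Lemma cLnormE D p f : 0 < p ->
  cLnorm D p%:E f = ((\int[mu]_(x in D) ((normc (f x)) `^ p)%:E) `^ p^-1)%E.
Proof.
move=> p0; rewrite /cLnorm unlock [in RHS]integral_mkcond; congr (_ `^ _)%E.
apply: eq_integral => x _; rewrite !patchE; case: ifPn => _.
  by rewrite abse_EFin poweR_EFin (ger0_norm (normc_ge0 _)).
by rewrite abse0 poweR_EFin powR0// gt_eqF.
Qed.

Lemma cLnorm_ge0 D (p : \bar R) f : (0 <= cLnorm D p f)%E.
Proof. exact: Lnorm_ge0. Qed.

Lemma measurable_powR_normc D p f : cmeasurable D f ->
  measurable_fun D (fun x => ((normc (f x)) `^ p)%:E).
Proof.
move=> mf; apply/measurable_EFinP.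
apply: (@measurableT_comp _ _ _ _ _ _ (@powR R ^~ p)) => //.
exact: measurable_normc.
Qed.

Lemma conj_exp_fin p : 1 < p -> conj_exp p%:E = p / (p - 1).
Proof.
move=> p1; rewrite /conj_exp /hoelder_conjugate/= eqe gt_eqF ?(lt_trans ltr01)//.
by rewrite -EFinD inver subr_eq0 gt_eqF.
Qed.

Lemma conj_expV (w : \bar R) : (1 < w)%E -> (conj_exp w)^-1 = 1 - fine w^-1.
Proof.
case: w => [r| |]//; last by rewrite /conj_exp hoelder_conjugatey invey/= invr1 subr0.
rewrite lte_fin => r1; rewrite conj_exp_fin// inver gt_eqF ?(lt_trans ltr01)//=.
by rewrite invf_div mulrBl mul1r divff// gt_eqF ?(lt_trans ltr01).
Qed.

Lemma conj_exp_ge1 (w : \bar R) : (1 < w)%E -> 1 <= conj_exp w.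
Proof.
case: w => [r| |]//.
rewrite lte_fin => r1; rewrite conj_exp_fin//.
by rewrite ler_pdivlMr ?subr_gt0// mul1r lerBlDl lerDr.
Qed.

Lemma cLnorm_hoelder_fin D p q f g : measurable D -> cmeasurable D f -> cmeasurable D g ->
  0 < p -> 0 < q -> p^-1 + q^-1 = 1 ->
  (\int[mu]_(x in D) (normc (f x * g x))%:E <= cLnorm D p%:E f * cLnorm D q%:E g)%E.
Proof.
move=> mD mf mg p0 q0 pq.
have mr h : cmeasurable D h -> measurable_fun setT ((fun x => normc (h x)) \_ D).
  by move=> mh; apply/(measurable_restrictT _ mD); exact: measurable_normc.
have := hoelder mu (mr _ mf) (mr _ mg) p0 q0 pq.
rewrite -!restrict_EFin Lnorm1; apply: le_trans.
rewrite [in leLHS]integral_mkcond le_eqVlt; apply/orP; left; apply/eqP.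
apply: eq_integral => x _ /=; rewrite !patchE; case: ifPn => _.
  by rewrite -Normc.normcM ger0_norm ?normc_ge0.
by rewrite mulr0 normr0.
Qed.

Lemma cLnorm_y_le D M f : (0 < mu D)%E -> measurable D ->
  (cLnorm D +oo%E f <= M%:E)%E -> {ae mu, forall x, D x -> normc (f x) <= M}.
Proof.
move=> D0 mD; rewrite /cLnorm unlock ifT; last first.
  by rewrite (lt_le_trans D0)// le_measure ?inE//.
move=> /ess_supP; apply: filterS => x /= + Dx.
by rewrite patchE mem_set//= lee_fin (ger0_norm (normc_ge0 _)).
Qed.

Lemma cLnorm_hoelder D (w : \bar R) M f g : (0 < mu D)%E -> measurable D ->
  cmeasurable D f -> cmeasurable D g -> (1 < w)%E -> 0 <= M ->
  (cLnorm D w f <= M%:E)%E ->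
  (\int[mu]_(x in D) (normc (f x * g x))%:E <=
   M%:E * cLnorm D (conj_exp w)%:E g)%E.
Proof.
move=> D0 mD mf mg w1 M0; case: w w1 => [r| |]// r1 fM.
  rewrite lte_fin in r1; have r0 : 0 < r by rewrite (lt_trans ltr01).
  have q0 : 0 < conj_exp r%:E :> R.
    by rewrite (lt_le_trans ltr01)// conj_exp_ge1// lte_fin.
  apply: le_trans (cLnorm_hoelder_fin mD mf mg r0 q0 _) _.
    by rewrite conj_expV ?lte_fin// inver gt_eqF//= subrKC.
  by rewrite lee_wpmul2r// cLnorm_ge0.
rewrite [conj_exp _]/conj_exp hoelder_conjugatey /= cLnormE// invr1.
rewrite poweRe1; last by apply: integral_ge0 => x _; rewrite lee_fin powR_ge0.
under [X in (_ <= _ * X)%E]eq_integral do rewrite powRr1 ?normc_ge0//.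
have mN := measurable_normcE mg.
rewrite -ge0_integralZl_EFin//; last by move=> x _; rewrite lee_fin normc_ge0.
apply: ae_ge0_le_integral => //.
- by move=> x _; rewrite lee_fin normc_ge0.
- by apply: measurable_normcE; exact: cmeasurableM.
- by move=> x _; rewrite -EFinM lee_fin mulr_ge0// normc_ge0.
- exact: measurable_funeM.
- apply: filterS (cLnorm_y_le D0 mD fM) => x h Dx.
  by rewrite -EFinM lee_fin Normc.normcM ler_wpM2r ?normc_ge0// h.
Qed.

Lemma powR_le1D p q M : 0 <= M -> 0 < p -> p <= q -> M `^ p <= 1 + M `^ q.
Proof.
move=> M0 p0 pq; have [M1|M1] := leP M 1.
  rewrite (@le_trans _ _ 1)// ?lerDl ?powR_ge0//.
  have -> : 1 = 1 `^ p :> R by rewrite powR1.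
  by rewrite ge0_ler_powR// ?nnegrE// ltW.
by rewrite (@le_trans _ _ (M `^ q))// ?lerDr// ler_powR// ltW.
Qed.

End Lnorm_theory.

Section Lspace_theory.
Context {R : realType} {n : nat}.
Implicit Types (D E : set (Rn R n)) (f g : Rn R n -> R[i]) (p q M : R).
Local Notation mu := (lebesgue R n).
Local Notation normc := (@Normc.normc R).

Lemma lee_poweR p (x y : \bar R) : 0 <= p -> (0 <= x)%E -> (x <= y)%E ->
  (x `^ p <= y `^ p)%E.
Proof.
move=> p0 x0 xy; apply: gt0_ler_poweR => //; rewrite in_itv/= leey andbT//.
exact: le_trans xy.
Qed.

Lemma integral_powR_ge0 D p f :
  (0 <= \int[mu]_(x in D) ((normc (f x)) `^ p)%:E)%E.
Proof. by apply: integral_ge0 => x _; rewrite lee_fin powR_ge0. Qed.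

Lemma cLnorm_poweR D p f : 0 < p ->
  (cLnorm D p%:E f `^ p = \int[mu]_(x in D) ((normc (f x)) `^ p)%:E)%E.
Proof.
move=> p0; rewrite cLnormE// -poweRrM mulVf ?gt_eqF// poweRe1//.
exact: integral_powR_ge0.
Qed.

Lemma cLnorm_lty D p f : 0 < p ->
  ((cLnorm D p%:E f < +oo) <->
   (\int[mu]_(x in D) ((normc (f x)) `^ p)%:E < +oo))%E.
Proof.
move=> p0; rewrite -cLnorm_poweR//; split; first exact: poweR_lty.
by apply: lty_poweRy; rewrite gt_eqF.
Qed.

Lemma le_integral_powR D p f g : measurable D -> 0 <= p ->
  cmeasurable D f -> cmeasurable D g ->
  (forall x, D x -> normc (f x) <= normc (g x)) ->
  (\int[mu]_(x in D) ((normc (f x)) `^ p)%:E <=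
   \int[mu]_(x in D) ((normc (g x)) `^ p)%:E)%E.
Proof.
move=> mD p0 mf mg fg; apply: ge0_le_integral => //.
- by move=> x _; rewrite lee_fin powR_ge0.
- exact: measurable_powR_normc.
- exact: measurable_powR_normc.
- by move=> x Dx; rewrite lee_fin ge0_ler_powR ?nnegrE ?normc_ge0// fg.
Qed.

Lemma le_cLnorm D p f g : measurable D -> 0 < p ->
  cmeasurable D f -> cmeasurable D g ->
  (forall x, D x -> normc (f x) <= normc (g x)) ->
  (cLnorm D p%:E f <= cLnorm D p%:E g)%E.
Proof.
move=> mD p0 mf mg fg; rewrite !cLnormE// lee_poweR ?invr_ge0 ?(ltW p0)//.
  exact: integral_powR_ge0.
by apply: le_integral_powR => //; exact: ltW.
Qed.

Lemma cLnormS D E p f : measurable D -> measurable E -> D `<=` E -> 0 < p ->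
  cmeasurable E f -> (cLnorm D p%:E f <= cLnorm E p%:E f)%E.
Proof.
move=> mD mE DE p0 mf; rewrite !cLnormE// lee_poweR ?invr_ge0 ?(ltW p0)//.
  exact: integral_powR_ge0.
apply: ge0_subset_integral => //; first exact: measurable_powR_normc.
by move=> x _; rewrite lee_fin powR_ge0.
Qed.

Lemma LspaceS D E p f : measurable D -> measurable E -> D `<=` E -> 0 < p ->
  Lspace E p%:E f -> Lspace D p%:E f.
Proof.
move=> mD mE DE p0 [mf fE]; split; first exact: cmeasurableS mf.
exact: le_lt_trans (cLnormS mD mE DE p0 mf) fE.
Qed.

Lemma cLnormD D p f g : measurable D -> 1 <= p -> cmeasurable D f ->
  cmeasurable D g ->
  (cLnorm D p%:E (fun x => f x + g x)%R <= cLnorm D p%:E f + cLnorm D p%:E g)%E.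
Proof.
move=> mD p1 mf mg; have p0 : 0 < p by rewrite (lt_le_trans ltr01).
have mr h : cmeasurable D h -> measurable_fun setT ((fun x => normc (h x)) \_ D).
  by move=> mh; apply/(measurable_restrictT _ mD); exact: measurable_normc.
have := @eminkowski _ _ _ mu _ _ p%:E (mr _ mf) (mr _ mg) p1.
rewrite -!restrict_EFin; apply: le_trans.
rewrite cLnormE// unlock lee_poweR ?invr_ge0 ?(ltW p0) ?integral_powR_ge0//.
rewrite [in leLHS]integral_mkcond; apply: ge0_le_integral => //.
- by move=> x _; rewrite patchE; case: ifPn => // _; rewrite lee_fin powR_ge0.
- exact: (iffLR (measurable_restrictT _ mD) (measurable_powR_normc p (cmeasurableD mf mg))).
- apply: (@measurableT_comp _ _ _ _ _ _ (fun x => (x `^ p)%E)).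
    exact: measurable_poweR.
  apply: (@measurableT_comp _ _ _ _ _ _ abse); first by [].
  apply/measurable_EFinP.
  by apply: measurable_funD; exact: mr.
- move=> x _; rewrite /= !patchE; case: ifPn => _; last by rewrite lee_fin powR_ge0.
  rewrite lee_fin ge0_ler_powR ?(ltW p0) ?nnegrE ?normc_ge0//.
  by rewrite ger0_norm ?addr_ge0 ?normc_ge0// normc_triangle.
Qed.

Lemma cLnormZ D p z f : measurable D -> 0 < p -> cmeasurable D f ->
  (cLnorm D p%:E (fun x => z * f x)%R = (normc z)%:E * cLnorm D p%:E f)%E.
Proof.
move=> mD p0 mf; rewrite !cLnormE//.
under eq_integral do rewrite Normc.normcM powRM ?normc_ge0// EFinM.
rewrite ge0_integralZl_EFin ?powR_ge0//; last first.
- exact: measurable_powR_normc.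
- by move=> x _; rewrite lee_fin powR_ge0.
rewrite poweRM ?lee_fin ?powR_ge0 ?integral_powR_ge0//.
by rewrite poweR_EFin -powRrM divff ?gt_eqF// powRr1 ?normc_ge0.
Qed.

Lemma LspaceD D p f g : measurable D -> 1 <= p -> Lspace D p%:E f ->
  Lspace D p%:E g -> Lspace D p%:E (fun x => f x + g x)%R.
Proof.
move=> mD p1 [mf fp] [mg gp]; split; first exact: cmeasurableD.
by rewrite (le_lt_trans (cLnormD mD p1 mf mg))// lte_add_pinfty.
Qed.

Lemma LspaceZ D p z f : measurable D -> 0 < p -> Lspace D p%:E f ->
  Lspace D p%:E (fun x => z * f x)%R.
Proof.
move=> mD p0 [mf fp]; split; first exact: cmeasurableZ.
by rewrite cLnormZ// lte_mul_pinfty// lee_fin normc_ge0.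
Qed.

Lemma LspaceB D p f g : measurable D -> 1 <= p -> Lspace D p%:E f ->
  Lspace D p%:E g -> Lspace D p%:E (fun x => f x - g x)%R.
Proof.
move=> mD p1 fp gp.
under eq_fun do rewrite -[in X in _ + X](mulN1r (g _)).
by apply: LspaceD => //; apply: LspaceZ => //; rewrite (lt_le_trans ltr01).
Qed.

Lemma Lspace_bounded D p M f : measurable D -> (mu D < +oo)%E -> 0 < p ->
  cmeasurable D f -> (forall x, D x -> normc (f x) <= M) -> Lspace D p%:E f.
Proof.
move=> mD muD p0 mf fM; split=> //; apply/cLnorm_lty => //.
apply: (@le_lt_trans _ _ (\int[mu]_(x in D) (`|M| `^ p)%:E)%E).
  apply: ge0_le_integral => //.
  - by move=> x _; rewrite lee_fin powR_ge0.
  - exact: measurable_powR_normc.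
  - move=> x Dx; rewrite lee_fin ge0_ler_powR ?(ltW p0) ?nnegrE ?normc_ge0//.
    by rewrite (le_trans (fM _ Dx))// ler_norm.
by rewrite integral_cst// lte_mul_pinfty// lee_fin powR_ge0.
Qed.

Lemma Lspace_cst D p z : measurable D -> (mu D < +oo)%E -> 0 < p ->
  Lspace D p%:E (fun=> z).
Proof.
by move=> mD muD p0; apply: (Lspace_bounded (M := normc z)).
Qed.

Lemma Lspace_cintegrable D p f : measurable D -> (mu D < +oo)%E -> 1 <= p ->
  Lspace D p%:E f -> cintegrable D f.
Proof.
move=> mD muD p1 [mf fp]; split=> //.
have p0 : 0 < p by rewrite (lt_le_trans ltr01).
apply: (@le_lt_trans _ _ (\int[mu]_(x in D) (1%:E + ((normc (f x)) `^ p)%:E))%E).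
  apply: ge0_le_integral => //.
  - by move=> x _; rewrite lee_fin normc_ge0.
  - exact: measurable_normcE.
  - by apply: emeasurable_funD => //; exact: measurable_powR_normc.
  - move=> x _; rewrite -EFinD lee_fin -[leLHS]powRr1 ?normc_ge0//.
    by rewrite powR_le1D ?normc_ge0.
rewrite ge0_integralD//; last 2 first.
  - by move=> x _; rewrite lee_fin powR_ge0.
  - exact: measurable_powR_normc.
by rewrite lte_add_pinfty//; [rewrite integral_cst// mul1e|exact/cLnorm_lty].
Qed.

End Lspace_theory.

(** * Truncation *)

Section truncation.
Context {R : realType}.
Local Notation normc := (@Normc.normc R).
Implicit Types (N : nat) (z : R[i]).

Definition rtrunc N (x : R) : R := Num.max (- N%:R) (Num.min x N%:R).

Definition ctrunc N z : R[i] :=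
  Complex (rtrunc N (complex.Re z)) (rtrunc N (complex.Im z)).

Lemma rtrunc_lip N (x y : R) : `|rtrunc N x - rtrunc N y| <= `|x - y|.
Proof.
have N0 : 0 <= N%:R :> R by [].
have P (t : R) : [\/ t <= - N%:R /\ rtrunc N t = - N%:R,
    - N%:R <= t <= N%:R /\ rtrunc N t = t | N%:R <= t /\ rtrunc N t = N%:R].
  rewrite /rtrunc; have [tN|/ltW Nt] := leP t N%:R.
    by case: leP => [|/ltW] h; [apply: Or31|apply: Or32; split=> //; apply/andP].
  by apply: Or33; split => //; apply/max_idPr; lra.
have h1 := ler_norm (x - y); have h2 := ler_norm (y - x); rewrite distrC in h2.
rewrite ler_norml; apply/andP.
by case: (P x) => [[a ->]|[/andP[a a'] ->]|[a ->]];
  case: (P y) => [[b ->]|[/andP[b b'] ->]|[b ->]]; split; lra.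
Qed.

Lemma ctrunc_lip N (z z' : R[i]) : normc (ctrunc N z - ctrunc N z') <= normc (z - z').
Proof.
case: z z' => a b [a' b'] /=.
have h (x y : R) : (rtrunc N x - rtrunc N y) ^+ 2 <= (x - y) ^+ 2.
  rewrite -[leLHS]real_normK ?num_real// -[leRHS]real_normK ?num_real//.
  by rewrite lerXn2r ?nnegrE// rtrunc_lip.
by rewrite ler_sqrt ?addr_ge0 ?sqr_ge0// lerD.
Qed.

Lemma rtrunc_id N (x : R) : `|x| <= N%:R -> rtrunc N x = x.
Proof.
rewrite ler_norml => /andP[h1 h2].
by rewrite /rtrunc (min_idPl h2) (max_idPr h1).
Qed.

Lemma ctrunc0 N : ctrunc N 0 = 0.
Proof. by rewrite /ctrunc !rtrunc_id ?normr0. Qed.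

Lemma ctrunc_le N z : normc (ctrunc N z) <= normc z.
Proof. by have := ctrunc_lip N z 0; rewrite ctrunc0 !subr0. Qed.

Lemma rtrunc_bound N (x : R) : `|rtrunc N x| <= N%:R.
Proof.
have N0 : 0 <= N%:R :> R by [].
rewrite ler_norml le_max lexx/= ge_max (le_trans _ N0) ?oppr_le0//=.
by rewrite ge_min lexx orbT.
Qed.

Lemma ctrunc_bound N z : normc (ctrunc N z) <= N%:R + N%:R.
Proof. by rewrite (le_trans (ler_normc_ReIm _))// lerD// rtrunc_bound. Qed.

Lemma ctrunc_id N z : normc z <= N%:R -> ctrunc N z = z.
Proof.
move=> zN; rewrite /ctrunc !rtrunc_id ?(le_trans _ zN)//; first by case: z {zN}.
  exact: ler_Im_normc.
exact: ler_Re_normc.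
Qed.

Lemma cmeasurable_ctrunc n (D : set (Rn R n)) N f : cmeasurable D f ->
  cmeasurable D (fun x => ctrunc N (f x)).
Proof.
by move=> [fr fi]; split; rewrite /= /rtrunc; apply: measurable_maxr => //;
  apply: measurable_minr.
Qed.

End truncation.

(** * Atoms *)

Section atoms.
Context {R : realType} {n : nat}.
Variables (v : R) (w : \bar R) (c0 : R) (Q0 : cube R n).
Hypotheses (v1 : 1 < v) (vw : (v%:E < w)%E).
Implicit Types (D : set (Rn R n)) (a f g : Rn R n -> R[i]) (Q : cube R n).
Local Notation mu := (lebesgue R n).
Local Notation normc := (@Normc.normc R).
Local Notation p := (conj_exp v%:E).
Local Notation q := (conj_exp w).

Lemma w_gt1 : (1 < w)%E.
Proof. by apply: lt_trans vw; rewrite lte_fin. Qed.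

Lemma v_gt0 : 0 < v.
Proof. exact: lt_trans v1. Qed.

Lemma p_ge1 : 1 <= p.
Proof. by apply: conj_exp_ge1; rewrite lte_fin. Qed.

Lemma p_gt0 : 0 < p.
Proof. exact: lt_le_trans p_ge1. Qed.

Lemma q_ge1 : 1 <= q.
Proof. by apply: conj_exp_ge1; exact: w_gt1. Qed.

Lemma q_gt0 : 0 < q.
Proof. exact: lt_le_trans q_ge1. Qed.

Lemma conj_exp_sum : v^-1 + p^-1 = 1.
Proof.
rewrite conj_expV ?lte_fin// inver gt_eqF ?v_gt0//=.
by rewrite addrCA subrr addr0.
Qed.

Lemma cset_fin Q : (mu (cset Q) < +oo)%E.
Proof. by rewrite lebesgue_cset ltry. Qed.

Lemma atom_integral_powR Q a : atom v w c0 Q a ->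
  (\int[mu]_(x in cset Q) ((normc (a x)) `^ v)%:E <= 2%:E)%E.
Proof.
case=> ma _ aw _.
have mQ := measurable_cset Q; have V0 := vol_gt0 Q; have v0 := v_gt0.
have mQa : cmeasurable (cset Q) a by exact: (cmeasurableS measurableT (@subsetT _ _) ma).
have ya : (cLnorm (cset Q) +oo a <= (vol Q `^ (- v^-1))%:E)%E ->
    (\int[mu]_(x in cset Q) ((normc (a x)) `^ v)%:E <= 2%:E)%E.
  move=> /(cLnorm_y_le (lebesgue_cset_gt0 Q) mQ) ae.
  apply: (@le_trans _ _ (\int[mu]_(x in cset Q) ((vol Q)^-1)%:E)%E).
    apply: ae_ge0_le_integral => //.
    - by move=> x _; rewrite lee_fin powR_ge0.
    - exact: measurable_powR_normc.
    - by move=> x _; rewrite lee_fin invr_ge0 ltW.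
    - apply: filterS ae => x h Qx; rewrite lee_fin.
      rewrite (@le_trans _ _ ((vol Q `^ (- v^-1)) `^ v))//.
        by rewrite ge0_ler_powR ?(ltW v0) ?nnegrE ?normc_ge0 ?powR_ge0// h.
      by rewrite -powRrM mulNr mulVf ?gt_eqF// powR_inv1// ltW.
  rewrite integral_cst// [X in (_ * X)%E](lebesgue_cset Q : _ = (vol Q)%:E).
  by rewrite -EFinM mulVf ?gt_eqF// lee_fin ler1n.
have ra r : v < r -> (cLnorm (cset Q) r%:E a <= (vol Q `^ (r^-1 - v^-1))%:E)%E ->
    (\int[mu]_(x in cset Q) ((normc (a x)) `^ v)%:E <= 2%:E)%E.
  move=> vr ar; have r0 : 0 < r by exact: lt_trans vr.
  have iar : (\int[mu]_(x in cset Q) ((normc (a x)) `^ r)%:E <=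
              (vol Q `^ (1 - r / v))%:E)%E.
    rewrite -cLnorm_poweR//.
    apply: le_trans (lee_poweR (ltW r0) (cLnorm_ge0 _ _ _) ar) _.
    by rewrite poweR_EFin -powRrM mulrBl mulVf ?gt_eqF// (mulrC _ r).
  pose A := vol Q `^ v^-1.
  have A0 : 0 <= A by exact: powR_ge0.
  have Av : A `^ v = vol Q by rewrite -powRrM mulVf ?gt_eqF// powRr1// ltW.
  have Ar : A `^ r = vol Q `^ (r / v) by rewrite -powRrM mulrC.
  apply: (@le_trans _ _ (\int[mu]_(x in cset Q)
     (((vol Q)^-1)%:E * (1%:E + (A `^ r)%:E * ((normc (a x)) `^ r)%:E)))%E).
    apply: ge0_le_integral => //.
    - by move=> x _; rewrite lee_fin powR_ge0.
    - exact: measurable_powR_normc.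
    - apply: measurable_funeM; apply: emeasurable_funD => //.
      by apply: measurable_funeM; exact: measurable_powR_normc.
    - move=> x _; rewrite -!(EFinM, EFinD) lee_fin ler_pdivlMl//.
      rewrite -Av -!powRM ?normc_ge0//.
      by apply: powR_le1D => //; [rewrite mulr_ge0 ?normc_ge0|exact: ltW].
  rewrite ge0_integralZl_EFin ?invr_ge0 ?(ltW V0)//; last 2 first.
  - by move=> x _; rewrite -EFinM -EFinD lee_fin addr_ge0// mulr_ge0// powR_ge0.
  - apply: emeasurable_funD => //.
    by apply: measurable_funeM; exact: measurable_powR_normc.
  rewrite ge0_integralD//; last 2 first.
  - by move=> x _; rewrite -EFinM lee_fin mulr_ge0// powR_ge0.
  - by apply: measurable_funeM; exact: measurable_powR_normc.
  rewrite ge0_integralZl_EFin ?powR_ge0//; last 2 first.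
  - by move=> x _; rewrite lee_fin powR_ge0.
  - exact: measurable_powR_normc.
  rewrite integral_cst// [X in (_ * (_ * X + _))%E](lebesgue_cset Q : _ = (vol Q)%:E).
  apply: (@le_trans _ _ ((vol Q)^-1%:E * (vol Q + A `^ r * vol Q `^ (1 - r / v))%:E)%E).
    rewrite lee_wpmul2l ?lee_fin ?invr_ge0 ?(ltW V0)// EFinD mul1e leeD2l//.
    by rewrite EFinM lee_wpmul2l// lee_fin powR_ge0.
  rewrite -EFinM lee_fin Ar -powRD; last by rewrite (gt_eqF V0) implybT.
  by rewrite subrKC powRr1 ?(ltW V0)// mulrDr mulVf ?gt_eqF.
case: w vw aw => [r| |]//; last first.
  by move=> _ aw; apply: ya; move: aw; rewrite invey sub0r.
rewrite lte_fin => vr; rewrite inver gt_eqF ?(lt_trans v0)//=; exact: ra.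
Qed.

Section atom_pairing.
Variables (Q : cube R n) (a : Rn R n -> R[i]).
Hypothesis atoma : atom v w c0 Q a.

Let mQ := measurable_cset Q.

Let ma : cmeasurable (cset Q) a.
Proof. by case: atoma => ma *; exact: (cmeasurableS measurableT (@subsetT _ _) ma). Qed.

Lemma atom_hoelder f : cmeasurable (cset Q) f ->
  (\int[mu]_(x in cset Q) (normc (a x * f x))%:E <=
   (vol Q `^ (fine w^-1 - v^-1))%:E * cLnorm (cset Q) q%:E f)%E.
Proof.
move=> mf; apply: cLnorm_hoelder => //.
- exact: lebesgue_cset_gt0.
- exact: w_gt1.
- exact: powR_ge0.
- by case: atoma.
Qed.

Lemma atom_cintegrable f : Lspace (cset Q) q%:E f ->
  cintegrable (cset Q) (fun x => a x * f x).
Proof.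
move=> [mf fq]; split; first exact: cmeasurableM.
rewrite (le_lt_trans (atom_hoelder mf))// lte_mul_pinfty// lee_fin.
exact: powR_ge0.
Qed.

Lemma Lspace_P0 f : Lspace (cset Q) q%:E f ->
  Lspace (cset Q) q%:E (fun x => f x - P0 c0 Q f).
Proof.
move=> fq; apply: LspaceB => //; first exact: q_ge1.
by apply: Lspace_cst => //; [exact: cset_fin|exact: q_gt0].
Qed.

Lemma oscE f : Lspace (cset Q) q%:E f ->
  ((vol Q `^ q^-1)%:E * osc q c0 Q f = cLnorm (cset Q) q%:E (fun x => f x - P0 c0 Q f)%R)%E.
Proof.
move=> fq; rewrite cLnormE ?q_gt0// /osc -poweR_EFin -poweRM.
- by rewrite muleA -EFinM divff ?gt_eqF ?vol_gt0// mul1e.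
- by rewrite lee_fin ltW// vol_gt0.
- by rewrite mule_ge0 ?integral_powR_ge0// lee_fin invr_ge0 ltW// vol_gt0.
Qed.

(* As [a] has mean zero on small cubes, [tau (f x)] may be replaced by
   [tau (f x) - tau (P f)], which is dominated by [f x - P f]. *)
Lemma atom_pairing_le (tau : R[i] -> R[i]) f :
  (forall z z', normc (tau z - tau z') <= normc (z - z')) -> tau 0 = 0 ->
  cmeasurable (cset Q) (fun x => tau (f x)) -> Lspace (cset Q) q%:E f ->
  ((normc (cint (cset Q) (fun x => (a x * tau (f x))%R)))%:E <=
   2%:E * ((vol Q `^ p^-1)%:E * osc q c0 Q f))%E.
Proof.
move=> tauL tau0 mtf fq; set c := tau (P0 c0 Q f).
have cq : Lspace (cset Q) q%:E (fun=> c).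
  by apply: Lspace_cst => //; [exact: cset_fin|exact: q_gt0].
have tfq : Lspace (cset Q) q%:E (fun x => tau (f x)).
  split=> //; apply: le_lt_trans fq.2; apply: le_cLnorm => //; first exact: q_gt0.
    by case: fq.
  by move=> x _; have := tauL (f x) 0; rewrite tau0 !subr0.
have tfcq : Lspace (cset Q) q%:E (fun x => tau (f x) - c).
  by apply: LspaceB => //; exact: q_ge1.
have -> : cint (cset Q) (fun x => a x * tau (f x)) =
          cint (cset Q) (fun x => a x * (tau (f x) - c)).
  transitivity (cint (cset Q) (fun x => a x * tau (f x) - a x * c)); last first.
    by apply: eq_cint => x _; rewrite mulrBr.
  rewrite cintB//; [|exact: atom_cintegrable|exact: atom_cintegrable].
  suff -> : cint (cset Q) (fun x => a x * c) = 0 by rewrite subr0.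
  have [sQ|sQ] := ltP (side Q) c0; last first.
    have -> : c = 0 by rewrite /c /P0 ltNge sQ.
    transitivity (cint (cset Q) (fun=> 0 * (0 : R[i]))).
      by apply: eq_cint => x _; rewrite mulr0 mul0r.
    rewrite cintZ ?mul0r//; split; first exact: cmeasurable_cst.
    by under eq_integral do rewrite Normc.normc0; rewrite integral0 ltry.
  transitivity (cint (cset Q) (fun x => c * a x)).
    by apply: eq_cint => x _; rewrite mulrC.
  have ai : cintegrable (cset Q) a.
    have a1 : cintegrable (cset Q) (fun x => a x * 1).
      apply: (atom_cintegrable (f := fun=> 1)).
      by apply: Lspace_cst => //; [exact: cset_fin|exact: q_gt0].
    by move: a1; under eq_fun do rewrite mulr1.
  by rewrite cintZ//; case: atoma => _ _ _ ->//; rewrite mulr0.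
apply: le_trans (normc_cint_le _ (atom_cintegrable tfcq)) _ => //.
rewrite lee_wpmul2l//.
apply: le_trans (atom_hoelder tfcq.1) _.
have -> : p^-1 = (fine w^-1 - v^-1) + q^-1.
  rewrite (conj_expV w_gt1); move: conj_exp_sum.
  by move: (fine _) (p^-1) (v^-1) => x y z; lra.
rewrite [in leRHS]powRD; last by rewrite (gt_eqF (vol_gt0 Q)) implybT.
rewrite EFinM -muleA oscE// lee_wpmul2l ?lee_fin ?powR_ge0//.
apply: le_cLnorm => //; first exact: q_gt0.
- exact: tfcq.1.
- by have [] := Lspace_P0 fq.
- by move=> x _; exact: tauL.
Qed.

End atom_pairing.

End atoms.

(** * Oscillation along packings *)

Section packing_sums.
Context {R : realType} {n : nat}.
Variables (v : R) (w : \bar R) (c0 : R) (Q0 : cube R n).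
Hypotheses (v1 : 1 < v) (vw : (v%:E < w)%E).
Implicit Types (f g : Rn R n -> R[i]) (J : set nat) (Q : nat -> cube R n).
Local Notation mu := (lebesgue R n).
Local Notation normc := (@Normc.normc R).
Local Notation p := (conj_exp v%:E).
Local Notation q := (conj_exp w).
Local Notation jn'_norm := (jn'_norm v w c0 Q0).
Local Notation jn' := (jn' v w c0 Q0).
Local Notation lnorm r b := (Lnorm (@counting nat R) r%:E (EFin \o b)).

Let p0 : 0 < p := p_gt0 v1.
Let q0 : 0 < q := q_gt0 v1 vw.

Lemma lnormE (r : R) (b : nat -> R) : 0 < r -> (forall j, 0 <= b j) ->
  lnorm r b = ((\sum_(j <oo) ((b j) `^ r)%:E) `^ r^-1)%E.
Proof.
move=> r0 b0; rewrite Lnorm_counting//; congr (_ `^ _)%E.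
by apply: eq_eseriesr => j _; rewrite /= ger0_norm.
Qed.

Lemma le_lnorm (r : R) (b b' : nat -> R) : 0 < r -> (forall j, 0 <= b j) ->
  (forall j, b j <= b' j) -> (lnorm r b <= lnorm r b')%E.
Proof.
move=> r0 b0 bb'; have b'0 j : 0 <= b' j by exact: le_trans (bb' j).
rewrite !lnormE// lee_poweR ?invr_ge0 ?(ltW r0)//.
  by apply: nneseries_ge0 => j _ _; rewrite lee_fin powR_ge0.
apply: lee_nneseries => j _; first by rewrite lee_fin powR_ge0.
by rewrite lee_fin ge0_ler_powR ?(ltW r0) ?nnegrE.
Qed.

Lemma lnormZ (r k : R) (b : nat -> R) : 0 < r -> 0 <= k -> (forall j, 0 <= b j) ->
  (lnorm r (fun j => k * b j)%R = k%:E * lnorm r b)%E.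
Proof.
move=> r0 k0 b0; rewrite !lnormE//; last by move=> j; rewrite mulr_ge0.
under eq_eseriesr do rewrite powRM// EFinM.
rewrite nneseriesZl; last by move=> j _; rewrite lee_fin powR_ge0.
rewrite poweRM ?lee_fin ?powR_ge0//; last first.
  by apply: nneseries_ge0 => j _ _; rewrite lee_fin powR_ge0.
by rewrite poweR_EFin -powRrM divff ?gt_eqF// powRr1.
Qed.

Lemma osc_ge0 (K : cube R n) f : (0 <= osc q c0 K f)%E.
Proof. exact: poweR_ge0. Qed.

Lemma osc_fin (K : cube R n) f : Lspace (cset K) q%:E f ->
  osc q c0 K f = (fine (osc q c0 K f))%:E.
Proof.
move=> /(Lspace_P0 c0 v1 vw) fq; rewrite fineK// ge0_fin_numE ?osc_ge0//.
rewrite poweR_lty// lte_mul_pinfty ?lee_fin ?invr_ge0 ?(ltW (vol_gt0 _))//.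
by apply/cLnorm_lty => //; case: fq.
Qed.

Lemma cavgD (K : cube R n) f g :
  cintegrable (cset K) f -> cintegrable (cset K) g ->
  cavg K (fun x => f x + g x) = cavg K f + cavg K g.
Proof.
move=> fi gi; rewrite /cavg cintD//; last exact: measurable_cset.
exact: mulrDr.
Qed.

Lemma cavgZ (K : cube R n) z f : cintegrable (cset K) f ->
  cavg K (fun x => z * f x) = z * cavg K f.
Proof.
move=> fi; rewrite /cavg cintZ//; last exact: measurable_cset.
exact: mulrCA.
Qed.

Lemma oscD (K : cube R n) f g :
  Lspace (cset K) q%:E f -> Lspace (cset K) q%:E g ->
  (osc q c0 K (fun x => f x + g x)%R <= osc q c0 K f + osc q c0 K g)%E.
Proof.
move=> fq gq; have mK := measurable_cset K.
have fi := Lspace_cintegrable mK (cset_fin K) (q_ge1 v1 vw) fq.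
have gi := Lspace_cintegrable mK (cset_fin K) (q_ge1 v1 vw) gq.
have V0 : 0 < vol K `^ q^-1 by rewrite powR_gt0// vol_gt0.
have fgq := LspaceD mK (q_ge1 v1 vw) fq gq.
rewrite -(lee_pmul2l _ (x := (vol K `^ q^-1)%:E))//.
rewrite muleDr//; last by rewrite ge0_adde_def ?inE ?osc_ge0.
rewrite [X in (X <= _)%E](oscE c0 v1 vw fgq).
rewrite [X in (_ <= X + _)%E](oscE c0 v1 vw fq).
rewrite [X in (_ <= _ + X)%E](oscE c0 v1 vw gq).
apply: le_trans (cLnormD mK (q_ge1 v1 vw) (Lspace_P0 c0 v1 vw fq).1 (Lspace_P0 c0 v1 vw gq).1).
apply: le_cLnorm => //.
- by have [] := Lspace_P0 c0 v1 vw fgq.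
- by apply: cmeasurableD; [case: (Lspace_P0 c0 v1 vw fq)|case: (Lspace_P0 c0 v1 vw gq)].
- move=> x _; rewrite /P0; case: ifP => _; last by rewrite !subr0.
  by rewrite cavgD// opprD addrACA.
Qed.

Lemma oscZ (K : cube R n) z f : Lspace (cset K) q%:E f ->
  osc q c0 K (fun x => z * f x) = ((normc z)%:E * osc q c0 K f)%E.
Proof.
move=> fq; have mK := measurable_cset K.
have fi := Lspace_cintegrable mK (cset_fin K) (q_ge1 v1 vw) fq.
have V0 : vol K `^ q^-1 != 0 by rewrite gt_eqF// powR_gt0// vol_gt0.
have zfq := LspaceZ z mK q0 fq.
have e (x : \bar R) : x = ((vol K `^ q^-1)^-1%:E * ((vol K `^ q^-1)%:E * x))%E.
  by rewrite muleA -EFinM mulVf// mul1e.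
rewrite [LHS]e [X in (_ * X)%E = _](oscE c0 v1 vw zfq).
rewrite [X in _ = (_ * X)%E]e [X in _ = (_ * (_ * X))%E](oscE c0 v1 vw fq).
rewrite muleCA -cLnormZ//; last by case: (Lspace_P0 c0 v1 vw fq).
congr (_ * cLnorm _ _ _)%E; apply/funext => x; rewrite mulrBr /P0.
by case: ifP => _; rewrite ?mulr0// cavgZ.
Qed.

Definition oscseq J Q f (j : nat) : R :=
  if j \in J then vol (Q j) `^ p^-1 * fine (osc q c0 (Q j) f) else 0.

Lemma oscseq_ge0 J Q f j : 0 <= oscseq J Q f j.
Proof.
by rewrite /oscseq; case: ifP => // _; rewrite mulr_ge0 ?powR_ge0 ?fine_ge0 ?osc_ge0.
Qed.

Lemma packing_Lspace J Q f j : packing Q0 J Q -> J j ->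
  Lspace (cset Q0) q%:E f -> Lspace (cset (Q j)) q%:E f.
Proof.
move=> [sub _] Jj; apply: LspaceS => //; [exact: measurable_cset..|exact: sub].
Qed.

Lemma lnorm_oscseq J Q f : packing Q0 J Q -> Lspace (cset Q0) q%:E f ->
  lnorm p (oscseq J Q f) =
  ((\esum_(j in J) ((vol (Q j))%:E * osc q c0 (Q j) f `^ p)) `^ p^-1)%E.
Proof.
move=> pJ fq; rewrite lnormE//; last by move=> j; exact: oscseq_ge0.
congr (_ `^ _)%E; rewrite nneseries_esumT; last by move=> j; rewrite lee_fin powR_ge0.
rewrite [RHS]esum_mkcond; apply: eq_esum => j _; rewrite /oscseq.
case: ifPn => [/set_mem Jj|_]; last by rewrite powR0// gt_eqF.
rewrite powRM ?powR_ge0 ?fine_ge0 ?osc_ge0// -powRrM mulVf ?gt_eqF//.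
rewrite powRr1 ?(ltW (vol_gt0 _))// EFinM -poweR_EFin -osc_fin//.
exact: packing_Lspace pJ Jj fq.
Qed.

Lemma lnorm_oscseq_le J Q f : packing Q0 J Q -> Lspace (cset Q0) q%:E f ->
  (lnorm p (oscseq J Q f) <= jn'_norm f)%E.
Proof.
move=> pJ fq; rewrite lnorm_oscseq//.
by apply: ereal_sup_ubound; exists J, Q.
Qed.

Lemma jn'_norm_ge0 f : (0 <= jn'_norm f)%E.
Proof.
rewrite /jn'_norm; apply: (@le_trans _ _ ((\esum_(j in set0)
   ((vol Q0)%:E * osc q c0 Q0 f `^ p)) `^ p^-1)%E); first exact: poweR_ge0.
apply: ereal_sup_ubound; exists set0, (fun=> Q0); split => //.
by split => // i [].
Qed.

Lemma jn'_norm_fin f : jn' f -> jn'_norm f = (fine (jn'_norm f))%:E.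
Proof. by move=> [_ fj]; rewrite fineK// ge0_fin_numE// jn'_norm_ge0. Qed.

Lemma jn'_normD f g : Lspace (cset Q0) q%:E f -> Lspace (cset Q0) q%:E g ->
  (jn'_norm (fun x => f x + g x)%R <= jn'_norm f + jn'_norm g)%E.
Proof.
move=> fq gq; have fgq := LspaceD (measurable_cset Q0) (q_ge1 v1 vw) fq gq.
apply: ub_ereal_sup => _ [J [Q [pJ ->]]].
rewrite -[X in (X <= _)%E](lnorm_oscseq pJ fgq).
apply: le_trans (leeD (lnorm_oscseq_le pJ fq) (lnorm_oscseq_le pJ gq)).
have mb (b : nat -> R) : measurable_fun setT b by [].
apply: le_trans (eminkowski counting (mb _) (mb _) _); last first.
  by rewrite lee_fin p_ge1.
apply: (le_lnorm p0) => j; first exact: oscseq_ge0.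
rewrite -[leRHS]/(oscseq J Q f j + oscseq J Q g j) /oscseq.
have [Jj|Jj] := boolP (j \in J); last by rewrite addr0.
have {Jj}Jj := set_mem Jj.
rewrite -mulrDr ler_wpM2l ?powR_ge0// -lee_fin EFinD.
have fjq := packing_Lspace pJ Jj fq; have gjq := packing_Lspace pJ Jj gq.
have fgjq := packing_Lspace pJ Jj fgq.
rewrite -[X in (X <= _)%E](osc_fin fgjq) -[X in (_ <= X + _)%E](osc_fin fjq).
rewrite -[X in (_ <= _ + X)%E](osc_fin gjq).
exact: oscD.
Qed.

Lemma jn'_normZ z f : Lspace (cset Q0) q%:E f ->
  (jn'_norm (fun x => z * f x)%R <= (normc z)%:E * jn'_norm f)%E.
Proof.
move=> fq; have zfq := LspaceZ z (measurable_cset Q0) q0 fq.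
apply: ub_ereal_sup => _ [J [Q [pJ ->]]].
rewrite -[X in (X <= _)%E](lnorm_oscseq pJ zfq).
have z0 : (0 <= (normc z)%:E)%E by rewrite lee_fin normc_ge0.
apply: le_trans (lee_wpmul2l z0 (lnorm_oscseq_le pJ fq)).
rewrite -lnormZ ?normc_ge0//; last by move=> j; exact: oscseq_ge0.
apply: (le_lnorm p0) => j; first exact: oscseq_ge0.
rewrite /oscseq; have [Jj|Jj] := boolP (j \in J); last by rewrite mulr0.
have {Jj}Jj := set_mem Jj; have fjq := packing_Lspace pJ Jj fq.
rewrite mulrCA ler_wpM2l ?powR_ge0// [X in fine X <= _](oscZ z fjq).
by rewrite (osc_fin fjq) -EFinM.
Qed.

Lemma jn'D f g : jn' f -> jn' g -> jn' (fun x => f x + g x).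
Proof.
move=> [fq fj] [gq gj].
have fgq := LspaceD (measurable_cset Q0) (q_ge1 v1 vw) fq gq.
by split; [exact: fgq|exact: le_lt_trans (jn'_normD fq gq) (lte_add_pinfty fj gj)].
Qed.

Lemma jn'Z z f : jn' f -> jn' (fun x => z * f x).
Proof.
move=> [fq fj]; have zfq := LspaceZ z (measurable_cset Q0) q0 fq.
split; first exact: zfq.
have z0 : (0 <= (normc z)%:E)%E by rewrite lee_fin normc_ge0.
apply: le_lt_trans (jn'_normZ z fq) _.
exact: (lte_mul_pinfty z0 (isT : (normc z)%:E \is a fin_num) fj).
Qed.

Lemma sum_vol_packing J Q : packing Q0 J Q ->
  (\esum_(j in J) (vol (Q j))%:E <= (vol Q0)%:E)%E.
Proof.
move=> [sub tJ].
have -> : (\esum_(j in J) (vol (Q j))%:E = \esum_(j in J) mu (cinterior (Q j)))%E.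
  by apply: eq_esum => j _; rewrite lebesgue_cinterior.
have -> : (\esum_(j in J) mu (cinterior (Q j)) =
           mu (\bigcup_(j in J) cinterior (Q j)))%E.
  rewrite measure_bigcup//; last by move=> j _; exact: measurable_cinterior.
  rewrite nneseries_esum//; congr esum; apply/seteqP; split => j /=.
    by move=> Jj; rewrite mem_set.
  by move/set_mem.
rewrite -lebesgue_cset; apply: le_measure; rewrite ?inE.
- by apply: bigcup_measurable => j _; exact: measurable_cinterior.
- exact: measurable_cset.
- by move=> x [j Jj /cinterior_sub]; exact: sub.
Qed.

Lemma bounded_P0 (K : cube R n) (M : R) f : cmeasurable (cset K) f -> 0 <= M ->
  (forall x, cset K x -> normc (f x) <= M) -> normc (P0 c0 K f) <= 2 * M.
Proof.
move=> mf M0 fM; rewrite /P0; case: ifP => _; last by rewrite Normc.normc0 mulr_ge0.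
have mK := measurable_cset K; have V0 := vol_gt0 K.
have fi : cintegrable (cset K) f.
  apply: (Lspace_cintegrable mK (cset_fin K) (lexx 1)).
  by apply: Lspace_bounded fM => //; exact: cset_fin.
rewrite /cavg Normc.normcM.
have -> : normc (real_complex R (vol K)^-1) = (vol K)^-1.
  by rewrite /= expr0n addr0 sqrtr_sqr ger0_norm// invr_ge0 ltW.
rewrite ler_pdivrMl// -lee_fin; apply: le_trans (normc_cint_le mK fi) _.
rewrite mulrCA EFinM lee_wpmul2l//.
apply: (@le_trans _ _ (\int[mu]_(x in cset K) M%:E)%E).
  apply: ge0_le_integral => //.
  - by move=> x _; rewrite lee_fin normc_ge0.
  - exact: measurable_normcE.
rewrite integral_cst//.
by rewrite [X in (_ * X)%E](lebesgue_cset K : _ = (vol K)%:E) -EFinM mulrC.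
Qed.

Lemma osc_bounded (K : cube R n) (M : R) f : cmeasurable (cset K) f -> 0 <= M ->
  (forall x, cset K x -> normc (f x) <= M) -> (osc q c0 K f <= (3 * M)%:E)%E.
Proof.
move=> mf M0 fM; have mK := measurable_cset K; have V0 := vol_gt0 K.
have -> : (3 * M)%:E = (((3 * M) `^ q)%:E `^ q^-1)%E.
  by rewrite poweR_EFin -powRrM divff ?gt_eqF// powRr1// mulr_ge0.
rewrite lee_poweR ?invr_ge0 ?(ltW q0)//.
  by rewrite mule_ge0 ?integral_powR_ge0// lee_fin invr_ge0 ltW.
rewrite lee_pdivrMl//.
have mfP : cmeasurable (cset K) (fun x => f x - P0 c0 K f).
  by apply: cmeasurableB => //; exact: cmeasurable_cst.
apply: (@le_trans _ _ (\int[mu]_(x in cset K) ((3 * M) `^ q)%:E)%E).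
  apply: ge0_le_integral => //.
  - by move=> x _; rewrite lee_fin powR_ge0.
  - exact: measurable_powR_normc.
  - move=> x Kx; rewrite lee_fin ge0_ler_powR ?(ltW q0) ?nnegrE ?normc_ge0 ?mulr_ge0//.
    rewrite (le_trans (normc_triangle _ _))// normcN.
    rewrite [leRHS](_ : _ = M + 2 * M); first by rewrite lerD ?fM ?bounded_P0.
    by lra.
rewrite integral_cst//.
by rewrite [X in (_ * X)%E](lebesgue_cset K : _ = (vol K)%:E) muleC.
Qed.

Lemma jn'_bounded (M : R) f : cmeasurable (cset Q0) f ->
  (forall x, cset Q0 x -> normc (f x) <= M) -> jn' f.
Proof.
move=> mf fM.
have {}fM x : cset Q0 x -> normc (f x) <= `|M|.
  by move=> /fM fxM; rewrite (le_trans fxM)// ler_norm.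
have fq : Lspace (cset Q0) q%:E f.
  by apply: Lspace_bounded fM => //; [exact: measurable_cset|exact: cset_fin].
split=> //; apply: (@le_lt_trans _ _ (((3 * `|M|) `^ p * vol Q0)%:E `^ p^-1)%E); last first.
  by rewrite poweR_lty// ltry.
apply: ub_ereal_sup => _ [J [Q [pJ ->]]].
have h0 j : (0 <= (vol (Q j))%:E * osc q c0 (Q j) f `^ p)%E.
  by rewrite mule_ge0 ?poweR_ge0// lee_fin ltW// vol_gt0.
rewrite lee_poweR ?invr_ge0 ?(ltW p0)//; first exact: esum_ge0.
apply: (@le_trans _ _ (\esum_(j in J) (((3 * `|M|) `^ p)%:E * (vol (Q j))%:E))%E).
  apply: le_esum => j Jj; rewrite muleC lee_wpmul2r ?lee_fin ?(ltW (vol_gt0 _))//.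
  rewrite -poweR_EFin lee_poweR ?(ltW p0) ?osc_ge0//.
  have sub : cset (Q j) `<=` cset Q0 by case: pJ => + _; exact.
  apply: osc_bounded => //; first exact: cmeasurableS (measurable_cset Q0) sub mf.
  by move=> x /sub; exact: fM.
have -> : (\esum_(j in J) (((3 * `|M|) `^ p)%:E * (vol (Q j))%:E) =
           ((3 * `|M|) `^ p)%:E * \esum_(j in J) (vol (Q j))%:E)%E.
  rewrite esum_mkcond -nneseries_esumT; last first.
    by move=> j; case: ifP => // _; rewrite -EFinM lee_fin mulr_ge0 ?powR_ge0 ?(ltW (vol_gt0 _)).
  rewrite [in RHS]esum_mkcond -nneseries_esumT; last first.
    by move=> j; case: ifP => // _; rewrite lee_fin ltW ?vol_gt0.
  rewrite -nneseriesZl; last by move=> j _; case: ifP => // _; rewrite lee_fin ltW ?vol_gt0.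
  by apply: eq_eseriesr => j _; case: ifP => // _; rewrite mule0.
by rewrite EFinM lee_wpmul2l ?lee_fin ?powR_ge0 ?sum_vol_packing.
Qed.

Lemma lnorm_hoelder (b b' : nat -> R) m :
  (forall j, 0 <= b j) -> (forall j, 0 <= b' j) ->
  ((\sum_(j < m) b j * b' j)%:E <= lnorm v b * lnorm p b')%E.
Proof.
move=> b0 b'0; have mb (c : nat -> R) : measurable_fun setT c by [].
apply: le_trans (hoelder counting (mb b) (mb b') (v_gt0 v1) p0 (conj_exp_sum v1)).
rewrite -[1%E]/(1%:E) lnormE//; last by move=> j; exact: mulr_ge0.
rewrite invr1 poweRe1; last by apply: nneseries_ge0 => j _ _; rewrite lee_fin powR_ge0.
under eq_eseriesr do rewrite /= powRr1 ?mulr_ge0//.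
apply: le_trans (nneseries_lim_ge m _); first by rewrite big_mkord sumEFin.
by move=> j _ _; rewrite lee_fin mulr_ge0.
Qed.

Lemma coef_normE (s : @atom_series R n) :
  coef_norm v s = lnorm v (fun j => normc (coef s j)).
Proof. by rewrite lnormE ?v_gt0// => j; exact: normc_ge0. Qed.

Lemma coef_norm_ge0 (s : @atom_series R n) : (0 <= coef_norm v s)%E.
Proof. exact: poweR_ge0. Qed.

Lemma coef_norm_fin (s : @atom_series R n) : (coef_norm v s < +oo)%E ->
  coef_norm v s = (fine (coef_norm v s))%:E.
Proof. by move=> sfin; rewrite fineK// ge0_fin_numE// coef_norm_ge0. Qed.

Definition contraction (tau : R[i] -> R[i]) : Prop :=
  [/\ forall z z', normc (tau z - tau z') <= normc (z - z'), tau 0 = 0 &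
      forall (D : set (Rn R n)) f, cmeasurable D f -> cmeasurable D (fun x => tau (f x))].

Lemma contraction_id : contraction id. Proof. by split. Qed.

Lemma contraction_ctrunc N : contraction (ctrunc N).
Proof.
split; [exact: ctrunc_lip|exact: ctrunc0|].
by move=> D f; exact: cmeasurable_ctrunc.
Qed.

Lemma admissible_pairing_dominated s f : admissible v w c0 Q0 s -> jn' f ->
  exists2 b : nat -> R,
    forall m, \sum_(j < m) b j <= 2 * (fine (coef_norm v s) * fine (jn'_norm f)) &
    forall tau j, contraction tau ->
      normc (coef s j * cint (cset (cubes_of s j))
        (fun x => atoms_of s j x * tau (f x))) <= b j.
Proof.
move=> [pJ sat s0 sfin] jf; have [fq _] := jf.
pose o := oscseq (idx s) (cubes_of s) f.
exists (fun j => 2 * (normc (coef s j) * o j)) => [m|tau j [tauL tau0 mtau]].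
  rewrite -mulr_sumr ler_wpM2l// -lee_fin.
  apply: le_trans (lnorm_hoelder m (fun j => normc_ge0 (coef s j)) (oscseq_ge0 _ _ f)) _.
  rewrite EFinM -(jn'_norm_fin jf) -(coef_norm_fin sfin) -coef_normE.
  by apply: lee_wpmul2l; [exact: coef_norm_ge0|exact: lnorm_oscseq_le pJ fq].
have [sj|sj] := pselect (idx s j); last first.
  by rewrite s0// mul0r Normc.normc0 mul0r mulr0.
rewrite Normc.normcM mulrCA ler_wpM2l ?normc_ge0// /o /oscseq mem_set//.
have fjq := packing_Lspace pJ sj fq.
have mtf : cmeasurable (cset (cubes_of s j)) (fun x => tau (f x)).
  exact: (mtau _ _ fjq.1).
rewrite -lee_fin; apply: le_trans (atom_pairing_le v1 vw (sat j sj) tauL tau0 mtf fjq) _.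
by rewrite (osc_fin fjq).
Qed.

End packing_sums.

Section pairings.
Context {R : realType} {n : nat}.
Implicit Types (D : set (Rn R n)) (a f g h : Rn R n -> R[i]).
Local Notation mu := (lebesgue R n).
Local Notation normc := (@Normc.normc R).

Lemma ecvg0P (u : nat -> \bar R) : (forall m, (0 <= u m)%E) ->
  (u @ \oo --> 0%E) <->
  (forall e : R, 0 < e -> exists N, forall m, (N <= m)%N -> (u m < e%:E)%E).
Proof.
move=> u0; split=> [/fine_cvgP[[N1 _ ufin] uc] e e0|h].
  have [N2 _ hN] := cvgr_distC_lt _ _ uc _ e0.
  exists (maxn N1 N2) => m; rewrite geq_max => /andP[m1 m2].
  have := hN _ m2; rewrite /= subr0 ger0_norm ?fine_ge0// -lte_fin fineK//.
  exact: ufin.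
apply/fine_cvgP; split.
  have [N hN] := h 1 ltr01; exists N => // m /hN um.
  by rewrite ge0_fin_numE// (lt_trans um)// ltry.
apply/cvgrPdistC_lt => e e0; have [N hN] := h e e0; exists N => // m /hN um.
rewrite /= subr0 ger0_norm ?fine_ge0// -lte_fin fineK//.
by rewrite ge0_fin_numE// (lt_trans um)// ltry.
Qed.

Lemma cint_restrict D D' f : D' `<=` D -> (forall x, f x != 0 -> D' x) ->
  cint D f = cint D' f.
Proof.
move=> D'D fD'.
have f0 x : ~ D' x -> f x = 0.
  by move=> D'x; apply/eqP/negPn/negP => /fD'.
rewrite -(setIidr D'D) /cint !Rintegral_mkcondr; congr Complex;
  apply: eq_Rintegral => x _; rewrite patchE; case: ifPn => // /negP D'x;
  by rewrite f0// => D'x'; apply: D'x; rewrite mem_set.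
Qed.

Lemma cint_ctrunc_cvg D a f : measurable D -> cmeasurable D a ->
  cmeasurable D f -> cintegrable D (fun x => a x * f x) ->
  ccvg (fun N => cint D (fun x => a x * ctrunc N (f x)))
       (cint D (fun x => a x * f x)).
Proof.
move=> mD ma mf iaf.
have mtf N := cmeasurable_ctrunc N mf.
have le1 N x : normc (a x * ctrunc N (f x)) <= normc (a x * f x).
  by rewrite !Normc.normcM ler_wpM2l ?normc_ge0 ?ctrunc_le.
have iatf N : cintegrable D (fun x => a x * ctrunc N (f x)).
  by apply: (le_cintegrable mD _ _ iaf) => [|x _]; [exact: cmeasurableM|exact: le1].
pose d N x := a x * ctrunc N (f x) - a x * f x.
have md N : cmeasurable D (d N) by apply: cmeasurableB; exact: cmeasurableM.
have id N : cintegrable D (d N).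
  split => //; have [_ +] := cintegrableD mD (iatf N) (cintegrableZ (-1) mD iaf).
  by under eq_integral do rewrite mulN1r.
pose b x := ((normc (a x * f x))%:E + (normc (a x * f x))%:E)%E.
have i2 : mu.-integrable D b.
  exact: (integrableD mD (cintegrable_norm mD iaf) (cintegrable_norm mD iaf)).
have [] := @dominated_convergence _ _ _ mu D mD
  (fun N x => (normc (d N x))%:E) (cst 0%E) b.
- by move=> N; exact: measurable_normcE.
- exact: measurable_cst.
- apply: aeW => x Dx; apply: cvg_near_cst; near=> N.
  by rewrite /d ctrunc_id ?subrr ?Normc.normc0//; near: N; exact: nbhs_infty_ger.
- exact: i2.
- apply: aeW => x N Dx; rewrite gee0_abs ?lee_fin ?normc_ge0//.
  by rewrite (le_trans (normc_triangle _ _))// normcN lerD2r le1.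
move=> _ _; rewrite integral0 => /(ecvg0P _).1 d0 e e0.
have e2 : 0 < e / 2 by rewrite divr_gt0.
have [|N hN] := d0 _ _ e2.
  by move=> m; apply: integral_ge0 => x _; rewrite lee_fin normc_ge0.
exists N => m /hN dm; rewrite -cintB// -lte_fin.
apply: le_lt_trans (normc_cint_le mD (id m)) _.
by rewrite muleC -lte_pdivlMr// mulrC.
Unshelve. all: by end_near.
Qed.

End pairings.

(** * Functionals defined by atomic series *)

Section functionals.
Context {R : realType} {n : nat}.
Variables (v : R) (w : \bar R) (c0 : R) (Q0 : cube R n).
Hypotheses (v1 : 1 < v) (vw : (v%:E < w)%E).
Implicit Types (f g h : Rn R n -> R[i]) (s : @atom_series R n).
Local Notation mu := (lebesgue R n).
Local Notation normc := (@Normc.normc R).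
Local Notation p := (conj_exp v%:E).
Local Notation q := (conj_exp w).
Local Notation jn'_norm := (jn'_norm v w c0 Q0).
Local Notation jn' := (jn' v w c0 Q0).

Let p0 : 0 < p := p_gt0 v1.
Let mQ0 := measurable_cset Q0.

Definition clim_series (T : nat -> (Rn R n -> R[i]) -> R[i]) f : R[i] :=
  clim (fun m => \sum_(i < m) T i f).

Lemma weak_star_sumP T phi : weak_star_sum v w c0 Q0 T phi <->
  forall f, jn' f -> ccvg (fun m => \sum_(i < m) T i f) (phi f).
Proof. by split=> h f jf; apply/ccvgP; exact: h. Qed.

Lemma weak_star_sum_unique T phi psi : weak_star_sum v w c0 Q0 T phi ->
  weak_star_sum v w c0 Q0 T psi -> dual_eq v w c0 Q0 phi psi.
Proof.
by move=> /weak_star_sumP h /weak_star_sumP h' f jf; exact: ccvg_unique (h f jf) (h' f jf).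
Qed.

Lemma abs_series_dual (T : nat -> (Rn R n -> R[i]) -> R[i]) (M : R) :
  (forall i k f g, jn' f -> jn' g ->
    T i (fun x => k * f x + g x) = k * T i f + T i g) ->
  (forall f m, jn' f -> \sum_(i < m) normc (T i f) <= M * fine (jn'_norm f)) ->
  [/\ jn_dual v w c0 Q0 (clim_series T),
      weak_star_sum v w c0 Q0 T (clim_series T) &
      forall f, jn' f -> normc (clim_series T f) <= M * fine (jn'_norm f)].
Proof.
move=> Tlin Tbd.
have Tc f : jn' f -> ccvg (fun m => \sum_(i < m) T i f) (clim_series T f) /\
    normc (clim_series T f) <= M * fine (jn'_norm f).
  move=> jf; have [l cl lM] := abs_series_ccvg (u := fun i => T i f) (fun m => Tbd f m jf).
  by rewrite /clim_series (climE cl).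
split; [|by apply/weak_star_sumP => f /Tc[]|by move=> f /Tc[]].
split; last first.
  exists M => f jf; rewrite (jn'_norm_fin jf) -EFinM lee_fin.
  by have [] := Tc f jf.
move=> k f g jf jg.
have jkfg : jn' (fun x => k * f x + g x) := jn'D v1 vw (jn'Z v1 vw k jf) jg.
apply: ccvg_unique (Tc _ jkfg).1 _.
apply: eq_ccvg (ccvgD (ccvgZ k (Tc _ jf).1) (Tc _ jg).1) => m.
by rewrite mulr_sumr -big_split; apply: eq_bigr => i _; rewrite Tlin.
Qed.

Lemma dterm_linear s j k f g : admissible v w c0 Q0 s -> jn' f -> jn' g ->
  dterm s j (fun x => k * f x + g x) = k * dterm s j f + dterm s j g.
Proof.
move=> [pJ sat s0 _] [fq _] [gq _]; rewrite /dterm.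
have [sj|sj] := pselect (idx s j); last by rewrite s0// !mul0r mulr0 addr0.
have mQ := measurable_cset (cubes_of s j).
have fjq := packing_Lspace v1 vw pJ sj fq; have gjq := packing_Lspace v1 vw pJ sj gq.
have afi := atom_cintegrable v1 vw (sat j sj) fjq.
have agi := atom_cintegrable v1 vw (sat j sj) gjq.
rewrite mulrCA -mulrDr; congr (_ * _); rewrite -(cintZ k mQ afi).
rewrite -(cintD mQ (cintegrableZ k mQ afi) agi).
by apply: eq_cint => x _; rewrite mulrDr mulrCA.
Qed.

Lemma dterm_bound s f m : admissible v w c0 Q0 s -> jn' f ->
  \sum_(j < m) normc (dterm s j f) <=
  2 * (fine (coef_norm v s) * fine (jn'_norm f)).
Proof.
move=> sad jf; have [b bM bd] := admissible_pairing_dominated v1 vw sad jf.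
apply: le_trans (bM m); apply: ler_sum => j _.
exact: (bd id j (contraction_id (n := n))).
Qed.

Definition series_functional s := clim_series (dterm s).

Lemma series_functionalP s : admissible v w c0 Q0 s ->
  [/\ jn_dual v w c0 Q0 (series_functional s),
      weak_star_sum v w c0 Q0 (dterm s) (series_functional s) &
      forall f, jn' f -> normc (series_functional s f) <=
        2 * fine (coef_norm v s) * fine (jn'_norm f)].
Proof.
move=> sad; apply: abs_series_dual => [j k f g jf jg|f m jf].
  exact: dterm_linear.
by rewrite -mulrA; exact: dterm_bound.
Qed.

Definition double_functional (S : nat -> @atom_series R n) :=
  clim_series (fun i => series_functional (S i)).

Lemma le_nneseries_term (u : nat -> \bar R) i : (forall j, (0 <= u j)%E) ->
  (u i <= \sum_(j <oo) u j)%E.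
Proof.
move=> u0; apply: le_trans (nneseries_lim_ge i.+1 (fun j _ _ => u0 j)).
by rewrite big_nat_recr//= leeDr// sume_ge0.
Qed.

Lemma coef_norm_partial_sum (S : nat -> @atom_series R n) m :
  (\sum_(i <oo) coef_norm v (S i) < +oo)%E ->
  \sum_(i < m) fine (coef_norm v (S i)) <= fine (\sum_(i <oo) coef_norm v (S i))%E.
Proof.
move=> Sfin.
have S0 i : (0 <= coef_norm v (S i))%E := coef_norm_ge0 v (S i).
have Sge0 : (0 <= \sum_(i <oo) coef_norm v (S i))%E by apply: nneseries_ge0.
rewrite -lee_fin fineK; last by rewrite ge0_fin_numE.
apply: le_trans (nneseries_lim_ge m _) => //.
rewrite big_mkord -sumEFin lee_sum// => i _.
by rewrite -coef_norm_fin//; exact: le_lt_trans (le_nneseries_term i S0) Sfin.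
Qed.

Lemma double_functionalP (S : nat -> @atom_series R n) :
  (forall i, admissible v w c0 Q0 (S i)) ->
  (\sum_(i <oo) coef_norm v (S i) < +oo)%E ->
  jn_dual v w c0 Q0 (double_functional S) /\
  weak_star_sum v w c0 Q0 (fun i => series_functional (S i)) (double_functional S).
Proof.
move=> Sad Sfin.
have [] := @abs_series_dual (fun i => series_functional (S i))
  (2 * fine (\sum_(i <oo) coef_norm v (S i))%E).
- move=> i k f g jf jg; have [[lin _] _ _] := series_functionalP (Sad i).
  exact: lin.
- move=> f m jf.
  apply: (@le_trans _ _ (\sum_(i < m) 2 * fine (coef_norm v (S i)) * fine (jn'_norm f))).
    by apply: ler_sum => i _; have [_ _] := series_functionalP (Sad i); exact.
  rewrite -mulr_suml ler_wpM2r ?fine_ge0 ?jn'_norm_ge0//.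
  by rewrite -mulr_sumr ler_wpM2l// coef_norm_partial_sum.
- by [].
Qed.

Lemma Lsum_pairing_ccvg (u : nat -> Rn R n -> R[i]) G h (M : R) :
  (forall j, Lspace (cset Q0) v%:E (u j)) -> Lspace (cset Q0) v%:E G ->
  Lsum (cset Q0) v%:E u G -> cmeasurable (cset Q0) h ->
  (forall x, normc (h x) <= M) ->
  ccvg (fun m => \sum_(j < m) cint (cset Q0) (fun x => u j x * h x))
       (cint (cset Q0) (fun x => G x * h x)).
Proof.
move=> uv Gv uG mh hM.
have hp : Lspace (cset Q0) p%:E h.
  by apply: (Lspace_bounded mQ0 (cset_fin Q0) p0 mh) => x _; exact: hM.
have hoel F : cmeasurable (cset Q0) F ->
    (\int[mu]_(x in cset Q0) (normc (F x * h x))%:E <=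
     cLnorm (cset Q0) v%:E F * cLnorm (cset Q0) p%:E h)%E.
  by move=> mF; apply: cLnorm_hoelder_fin => //; [exact: v_gt0|exact: conj_exp_sum].
have hfin := hp.2.
pose H := fine (cLnorm (cset Q0) p%:E h).
have HE : cLnorm (cset Q0) p%:E h = H%:E.
  by apply/esym/fineK; rewrite ge0_fin_numE ?cLnorm_ge0.
have H0 : 0 <= H by rewrite fine_ge0// cLnorm_ge0.
have Fi F : Lspace (cset Q0) v%:E F -> cintegrable (cset Q0) (fun x => F x * h x).
  move=> [mF Ffin]; split; first exact: cmeasurableM.
  apply: le_lt_trans (hoel _ mF) _; rewrite HE.
  by rewrite muleC lte_mul_pinfty ?lee_fin.
move=> e e0; pose d := e / (2 * (H + 1)).
have d0 : 0 < d by rewrite divr_gt0// mulr_gt0// ltr_wpDl.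
have [|N hN] := (ecvg0P (u := fun m => cLnorm (cset Q0) v%:E
    (fun x => (\sum_(i < m) u i x) - G x)) _).1 uG d d0.
  by move=> m; exact: cLnorm_ge0.
exists N => m /hN um.
have [ui us] := cint_sum m mQ0 (fun j => Fi _ (uv j)).
rewrite -us -(cintB mQ0 ui (Fi _ Gv)).
have mD : cmeasurable (cset Q0) (fun x => (\sum_(i < m) u i x) - G x).
  by apply: cmeasurableB; [apply: cmeasurable_sum => i; case: (uv i)|case: Gv].
have -> : cint (cset Q0) (fun x => \sum_(i < m) u i x * h x - G x * h x) =
          cint (cset Q0) (fun x => ((\sum_(i < m) u i x) - G x) * h x).
  by apply: eq_cint => x _; rewrite mulrBl mulr_suml.
have Di : cintegrable (cset Q0) (fun x => ((\sum_(i < m) u i x) - G x) * h x).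
  apply: Fi; split; first exact: mD.
  by apply: lt_trans um _; rewrite ltry.
rewrite -lte_fin; apply: le_lt_trans (normc_cint_le mQ0 Di) _.
apply: (@le_lt_trans _ _ (2%:E * (d%:E * H%:E))%E).
  rewrite lee_wpmul2l//; apply: le_trans (hoel _ mD) _; rewrite HE.
  by rewrite lee_wpmul2r ?lee_fin// ltW.
rewrite -!EFinM lte_fin.
have dE : d * (2 * (H + 1)) = e.
  by rewrite divfK// gt_eqF// mulr_gt0// ltr_wpDl.
by rewrite -[ltRHS]dE; clear dE; nra.
Qed.

End functionals.

(** * From functions to functionals *)

Section function_to_functional.
Context {R : realType} {n : nat}.
Variables (v : R) (w : \bar R) (c0 : R) (Q0 : cube R n).
Hypotheses (v1 : 1 < v) (vw : (v%:E < w)%E).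
Implicit Types (f g h : Rn R n -> R[i]) (s : @atom_series R n).
Implicit Types (S : nat -> @atom_series R n).
Local Notation mu := (lebesgue R n).
Local Notation normc := (@Normc.normc R).
Local Notation p := (conj_exp v%:E).
Local Notation q := (conj_exp w).
Local Notation jn'_norm := (jn'_norm v w c0 Q0).
Local Notation jn' := (jn' v w c0 Q0).

Let mQ0 := measurable_cset Q0.
Let v0 : 0 < v := v_gt0 v1.

Lemma cmeasurable_fterm s j : admissible v w c0 Q0 s ->
  cmeasurable setT (fterm s j).
Proof.
move=> [_ sat s0 _]; have [sj|sj] := pselect (idx s j).
  by apply: cmeasurableZ; case: (sat j sj).
apply: (eq_cmeasurable _ (cmeasurable_cst setT 0)) => x _.
by rewrite /fterm s0// mul0r.
Qed.

Lemma fterm_integral_powR s j : admissible v w c0 Q0 s ->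
  (\int[mu]_(x in cset Q0) ((normc (fterm s j x)) `^ v)%:E <=
   (2 * normc (coef s j) `^ v)%:E)%E.
Proof.
move=> [[sub _] sat s0 _]; have [sj|sj] := pselect (idx s j); last first.
  under eq_integral => x _.
    rewrite /fterm s0// mul0r Normc.normc0 powR0 ?gt_eqF//.
    over.
  by rewrite integral0 lee_fin mulr_ge0// powR_ge0.
have [ma supp _ _] := sat j sj; have Qj := sub j sj.
have mQ := measurable_cset (cubes_of s j).
have mQa : cmeasurable (cset (cubes_of s j)) (atoms_of s j).
  exact: cmeasurableS measurableT (@subsetT _ _) ma.
under eq_integral do rewrite Normc.normcM powRM ?normc_ge0// EFinM.
have -> : (\int[mu]_(x in cset Q0) ((normc (coef s j) `^ v)%:E *
    (normc (atoms_of s j x) `^ v)%:E) = \int[mu]_(x in cset (cubes_of s j))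
    ((normc (coef s j) `^ v)%:E * (normc (atoms_of s j x) `^ v)%:E))%E.
  rewrite -(setIidr Qj) integral_mkcondr; apply: eq_integral => x _.
  rewrite patchE; case: ifPn => // /negP xQ.
  have -> : atoms_of s j x = 0.
    by apply/eqP/negPn/negP => /supp /mem_set.
  by rewrite Normc.normc0 powR0 ?gt_eqF// mule0.
rewrite ge0_integralZl_EFin ?powR_ge0//; last 2 first.
- by move=> x _; rewrite lee_fin powR_ge0.
- exact: measurable_powR_normc.
rewrite mulrC EFinM lee_wpmul2l ?lee_fin ?powR_ge0//.
by have := atom_integral_powR v1 vw (sat j sj); exact.
Qed.

Lemma fterm_Lspace s j : admissible v w c0 Q0 s ->
  Lspace (cset Q0) v%:E (fterm s j).
Proof.
move=> sad; split.
  exact: cmeasurableS measurableT (@subsetT _ _) (cmeasurable_fterm j sad).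
apply/(cLnorm_lty _ _ v0).
by apply: le_lt_trans (fterm_integral_powR j sad) _; rewrite ltry.
Qed.

Lemma cint_fterm s j h : admissible v w c0 Q0 s ->
  cmeasurable (cset Q0) h -> (exists M, forall x, normc (h x) <= M) ->
  cint (cset Q0) (fun x => fterm s j x * h x) =
  coef s j * cint (cset (cubes_of s j)) (fun x => atoms_of s j x * h x).
Proof.
move=> [[sub _] sat s0 _] mh [M hM].
have [sj|sj] := pselect (idx s j); last first.
  rewrite s0// mul0r /cint /Rintegral.
  under eq_integral do rewrite /fterm s0// !mul0r.
  under [X in Complex _ (fine X)]eq_integral do rewrite /fterm s0// !mul0r.
  by rewrite /= integral0.
have mQ := measurable_cset (cubes_of s j).
have [_ supp _ _] := sat j sj; have Qj := sub j sj.
have hq : Lspace (cset (cubes_of s j)) q%:E h.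
  apply: (Lspace_bounded (M := M) mQ (cset_fin _) (q_gt0 v1 vw)) => //.
  exact: cmeasurableS mQ0 Qj mh.
rewrite -(cintZ _ mQ (atom_cintegrable v1 vw (sat j sj) hq)).
under [RHS]eq_cint do rewrite mulrA.
apply: cint_restrict => // x; rewrite /fterm => ne0; apply: supp => /=.
by apply: contra_neq ne0 => ->; rewrite mulr0 mul0r.
Qed.

Lemma bounded_ctrunc N f : exists M, forall x : Rn R n, normc (ctrunc N (f x)) <= M.
Proof. by exists (N%:R + N%:R) => x; exact: ctrunc_bound. Qed.

Lemma series_pairing_ccvg s G f : admissible v w c0 Q0 s ->
  Lspace (cset Q0) v%:E G -> Lsum (cset Q0) v%:E (fterm s) G -> jn' f ->
  ccvg (fun N => cint (cset Q0) (fun x => G x * ctrunc N (f x)))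
       (series_functional s f) /\
  forall N, normc (cint (cset Q0) (fun x => G x * ctrunc N (f x))) <=
    2 * fine (coef_norm v s) * fine (jn'_norm f).
Proof.
move=> sad Gv sG jf; have [fq _] := jf.
have [b bM bd] := admissible_pairing_dominated v1 vw sad jf.
have [_ /weak_star_sumP wc _] := series_functionalP v1 vw sad.
pose u N j := coef s j * cint (cset (cubes_of s j))
  (fun x => atoms_of s j x * ctrunc N (f x)).
have ub N j : normc (u N j) <= b j := bd _ j (contraction_ctrunc N).
have mtf N : cmeasurable (cset Q0) (fun x => ctrunc N (f x)).
  exact: cmeasurable_ctrunc fq.1.
have uA N : ccvg (fun m => \sum_(j < m) u N j)
    (cint (cset Q0) (fun x => G x * ctrunc N (f x))).
  have [M hM] := bounded_ctrunc N f.
  apply: eq_ccvg (Lsum_pairing_ccvg v1 (fun j => fterm_Lspace j sad) Gv sG (mtf N) hM) => m.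
  by apply: eq_bigr => j _; rewrite cint_fterm//; exists M.
split.
  apply: (series_dominated_ccvg (l := fun j => dterm s j f) ub bM _ uA (wc f jf)) => j.
  have [pJ sat s0 _] := sad; have mQ := measurable_cset (cubes_of s j).
  have [sj|sj] := pselect (idx s j); last first.
    rewrite /dterm /= s0// mul0r; apply: eq_ccvg (ccvg_cst 0) => N.
    by rewrite /u /= s0// mul0r.
  apply: ccvgZ; have fjq := packing_Lspace v1 vw pJ sj fq.
  apply: (cint_ctrunc_cvg mQ _ fjq.1 (atom_cintegrable v1 vw (sat j sj) fjq)).
  by have [ma _ _ _] := sat j sj; exact: cmeasurableS measurableT (@subsetT _ _) ma.
move=> N; apply: ccvg_norm_le (uA N); exists 0%N => m _.
rewrite -mulrA; apply: le_trans (bM m).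
by apply: le_trans (normc_sum _ _ _) _; apply: ler_sum => j _.
Qed.

Definition pairing g f : R[i] :=
  clim (fun N => cint (cset Q0) (fun x => g x * ctrunc N (f x))).

Lemma double_pairing_ccvg S g f : Lspace (cset Q0) v%:E g ->
  hkhat_decomp v w c0 Q0 g S -> jn' f ->
  ccvg (fun N => cint (cset Q0) (fun x => g x * ctrunc N (f x)))
       (double_functional S f).
Proof.
move=> gv [Sad Sfin [G [Gv SG Gg]]] jf; have [fq _] := jf.
have [_ /weak_star_sumP wc] := double_functionalP v1 vw Sad Sfin.
have sp i := series_pairing_ccvg (Sad i) (Gv i) (SG i) jf.
have mtf N : cmeasurable (cset Q0) (fun x => ctrunc N (f x)).
  exact: cmeasurable_ctrunc fq.1.
pose b i := 2 * fine (coef_norm v (S i)) * fine (jn'_norm f).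
have bM m : \sum_(i < m) b i <=
    2 * fine (\sum_(i <oo) coef_norm v (S i))%E * fine (jn'_norm f).
  rewrite -mulr_suml ler_wpM2r ?fine_ge0 ?jn'_norm_ge0//.
  by rewrite -mulr_sumr ler_wpM2l// coef_norm_partial_sum.
pose u N i := cint (cset Q0) (fun x => G i x * ctrunc N (f x)).
have ub N i : normc (u N i) <= b i := (sp i).2 N.
have uA N : ccvg (fun m => \sum_(i < m) u N i)
    (cint (cset Q0) (fun x => g x * ctrunc N (f x))).
  have [M hM] := bounded_ctrunc N f.
  by have := Lsum_pairing_ccvg v1 Gv gv Gg (mtf N) hM; exact.
exact: series_dominated_ccvg ub bM (fun i => (sp i).1) uA (wc f jf).
Qed.

Lemma pairingE S g : hkhat v w c0 Q0 g -> hkhat_decomp v w c0 Q0 g S ->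
  dual_eq v w c0 Q0 (pairing g) (double_functional S).
Proof.
by move=> [gv _] gS f jf; exact: climE (double_pairing_ccvg gv gS jf).
Qed.

Lemma weak_star_sum_eq T phi psi : dual_eq v w c0 Q0 phi psi ->
  weak_star_sum v w c0 Q0 T psi -> weak_star_sum v w c0 Q0 T phi.
Proof. by move=> pp h f jf; rewrite (pp f jf); exact: h. Qed.

Lemma jn_dual_eq phi psi : dual_eq v w c0 Q0 phi psi ->
  jn_dual v w c0 Q0 psi -> jn_dual v w c0 Q0 phi.
Proof.
move=> pp [lin [M bd]]; split; last first.
  by exists M => f jf; rewrite (pp f jf); exact: bd.
move=> k f g jf jg; rewrite (pp f jf) (pp g jg).
by rewrite (pp _ (jn'D v1 vw (jn'Z v1 vw k jf) jg)); exact: lin.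
Qed.

Lemma dual_double_sum_pairing S g : hkhat v w c0 Q0 g ->
  hkhat_decomp v w c0 Q0 g S -> dual_double_sum v w c0 Q0 S (pairing g).
Proof.
move=> gh gS; have [Sad Sfin _] := gS; have pp := pairingE gh gS.
have [dd ws] := double_functionalP v1 vw Sad Sfin.
split; first exact: jn_dual_eq pp dd.
exists (fun i => series_functional (S i)); split.
- by move=> i; have [] := series_functionalP v1 vw (Sad i).
- by move=> i; have [] := series_functionalP v1 vw (Sad i).
- exact: weak_star_sum_eq pp ws.
Qed.

Lemma hkt_series_functional s : admissible v w c0 Q0 s ->
  hkt v w c0 Q0 (series_functional s) /\
  (hkt_norm v w c0 Q0 (series_functional s) <= coef_norm v s)%E.
Proof.
move=> sad; have [sd ws _] := series_functionalP v1 vw sad.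
have dec : hkt_decomp v w c0 Q0 (series_functional s) s by [].
split; first by split => //; exists s.
by apply: ereal_inf_lbound; exists s.
Qed.

Lemma hkt_norm_ge0 phi : (0 <= hkt_norm v w c0 Q0 phi)%E.
Proof. by apply: le_ereal_inf_tmp => _ [s _ <-]; exact: coef_norm_ge0. Qed.

Lemma pairing_hk_decomp S g : hkhat v w c0 Q0 g ->
  hkhat_decomp v w c0 Q0 g S ->
  exists2 T, hk_decomp v w c0 Q0 (pairing g) T &
    (\sum_(i <oo) hkt_norm v w c0 Q0 (T i) <= \sum_(i <oo) coef_norm v (S i))%E.
Proof.
move=> gh gS; have [Sad Sfin _] := gS; have pp := pairingE gh gS.
have [_ ws] := double_functionalP v1 vw Sad Sfin.
have le : (\sum_(i <oo) hkt_norm v w c0 Q0 (series_functional (S i)) <=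
           \sum_(i <oo) coef_norm v (S i))%E.
  apply: lee_nneseries => [i _ _|i _]; first exact: hkt_norm_ge0.
  exact: (hkt_series_functional (Sad i)).2.
exists (fun i => series_functional (S i)); last exact: le.
split.
- by move=> i; exact: (hkt_series_functional (Sad i)).1.
- exact: weak_star_sum_eq pp ws.
- exact: le_lt_trans le Sfin.
Qed.

Lemma hk_pairing g : hkhat v w c0 Q0 g -> hk v w c0 Q0 (pairing g).
Proof.
move=> gh; have [_ [S gS]] := gh.
have [T gT _] := pairing_hk_decomp gh gS.
split; last by exists T.
by have [] := dual_double_sum_pairing gh gS.
Qed.

Lemma hk_norm_pairing_le g : hkhat v w c0 Q0 g ->
  (hk_norm v w c0 Q0 (pairing g) <= hkhat_norm v w c0 Q0 g)%E.
Proof.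
move=> gh; apply: le_ereal_inf_tmp => _ [S gS <-].
have [T gT le] := pairing_hk_decomp gh gS.
by apply: le_trans le; apply: ereal_inf_lbound; exists T.
Qed.

Lemma eq_ae_pairing g h : hkhat v w c0 Q0 g -> hkhat v w c0 Q0 h ->
  g = h %[ae mu in cset Q0] -> dual_eq v w c0 Q0 (pairing g) (pairing h).
Proof.
move=> [[mg _] _] [[mh _] _] gh f [[mf _] _]; rewrite /pairing; congr clim.
apply/funext => N; have mtf := cmeasurable_ctrunc N mf.
apply: ae_eq_cint => //; [exact: cmeasurableM|exact: cmeasurableM|].
by apply: filterS gh => x e /e ->.
Qed.

End function_to_functional.

(** * Completeness of Lebesgue spaces *)

Lemma ccvg_Re (R : realType) (u : nat -> R[i]) (l : R[i]) : ccvg u l ->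
  (fun m => complex.Re (u m)) @ \oo --> complex.Re l.
Proof.
move=> ul; apply/cvgrPdistC_lt => e e0; have [N hN] := ul e e0.
exists N => // m /hN; apply: le_lt_trans => /=.
by have := ler_Re_normc (u m - l); rewrite cReD cReN.
Qed.

Lemma ccvg_Im (R : realType) (u : nat -> R[i]) (l : R[i]) : ccvg u l ->
  (fun m => complex.Im (u m)) @ \oo --> complex.Im l.
Proof.
move=> ul; apply/cvgrPdistC_lt => e e0; have [N hN] := ul e e0.
exists N => // m /hN; apply: le_lt_trans => /=.
by have := ler_Im_normc (u m - l); rewrite cImD cImN.
Qed.

Section monotone_sup.
Context d (T : measurableType d) (R : realType) (mu : {measure set T -> \bar R}).
Variables (D : set T) (phi : nat -> T -> \bar R) (K : \bar R).
Hypotheses (mD : measurable D) (mphi : forall k, measurable_fun D (phi k)).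
Hypothesis phi0 : forall k x, (0 <= phi k x)%E.
Hypothesis nd : forall x, nondecreasing_seq (phi ^~ x).

Lemma measurable_sup_nondecreasing :
  measurable_fun D (fun x => ereal_sup (range (phi ^~ x))).
Proof.
apply: (emeasurable_fun_cvg _ _ mphi) => x _; exact: ereal_nondecreasing_cvgn.
Qed.

Lemma integral_sup_nondecreasing : (forall k, \int[mu]_(x in D) phi k x <= K)%E ->
  (\int[mu]_(x in D) ereal_sup (range (phi ^~ x)) <= K)%E.
Proof.
move=> phiK; have := @cvg_monotone_convergence _ _ _ mu D mD phi mphi
  (fun k x _ => phi0 k x) (fun x _ => nd x).
have -> : (fun x => limn (phi ^~ x)) = (fun x => ereal_sup (range (phi ^~ x))).
  by apply/funext => x; apply/cvg_lim => //; exact: ereal_nondecreasing_cvgn.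
by move=> h; apply: (cvge_to_le h); apply: nearW => k; exact: phiK.
Qed.

End monotone_sup.

Section Lv_completeness.
Context {R : realType} {n : nat}.
Variables (v : R) (D : set (Rn R n)) (u : nat -> Rn R n -> R[i]).
Hypotheses (v0 : 0 < v) (mD : measurable D).
Hypothesis mu_ : forall i, cmeasurable D (u i).
Local Notation mu := (lebesgue R n).
Local Notation normc := (@Normc.normc R).

Let A m k x := \sum_(m <= i < k) normc (u i x).

Let A0 m k x : 0 <= A m k x.
Proof. by apply: sumr_ge0 => i _; exact: normc_ge0. Qed.

Let And m x k k' : (k <= k')%N -> A m k x <= A m k' x.
Proof.
move=> kk'; have [mk|/ltnW km] := leqP m k; last by rewrite {1}/A big_geq.
by rewrite /A (big_cat_nat mk kk')/= lerDl; exact: (A0 k k' x).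
Qed.

Let Anm m m' k x : (m <= m')%N -> A m' k x <= A m k x.
Proof.
move=> mm'; have [m'k|/ltnW km] := leqP m' k; last by rewrite {1}/A big_geq.
by rewrite /A [leRHS](big_cat_nat mm' m'k)/= lerDr; exact: (A0 m m' x).
Qed.

Let mA m k : measurable_fun D (fun x => (A m k x `^ v)%:E).
Proof.
apply/measurable_EFinP; apply: (@measurableT_comp _ _ _ _ _ _ (@powR R ^~ v)) => //.
by apply: measurable_sum => i; exact: measurable_normc.
Qed.

Let H m x : \bar R := ereal_sup (range (fun k => (A m k x `^ v)%:E)).

Let mH m : measurable_fun D (H m).
Proof.
apply: (@measurable_sup_nondecreasing _ _ R D (fun k x => (A m k x `^ v)%:E)) => //.
by move=> x k k' kk'; rewrite lee_fin ge0_ler_powR ?(ltW v0) ?nnegrE ?And.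
Qed.

Let iH m K : (forall k, \int[mu]_(x in D) (A m k x `^ v)%:E <= K)%E ->
  (\int[mu]_(x in D) H m x <= K)%E.
Proof.
apply: (@integral_sup_nondecreasing _ _ R mu D (fun k x => (A m k x `^ v)%:E)) => //.
- by move=> k x; rewrite lee_fin powR_ge0.
- by move=> x k k' kk'; rewrite lee_fin ge0_ler_powR ?(ltW v0) ?nnegrE ?And.
Qed.

Let H0 m x : (0 <= H m x)%E.
Proof.
by apply: le_trans (ereal_sup_ubound (ex_intro2 _ _ 0%N I erefl)); rewrite lee_fin powR_ge0.
Qed.

Let AH m k x : (H m x < +oo)%E -> A m k x <= fine (H m x) `^ v^-1.
Proof.
move=> Hfin.
have : ((A m k x `^ v)%:E <= H m x)%E by apply: ereal_sup_ubound; exists k.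
rewrite -[X in (_ <= X)%E]fineK ?ge0_fin_numE// lee_fin => h.
have -> : A m k x = (A m k x `^ v) `^ v^-1 by rewrite -powRrM divff ?gt_eqF// powRr1.
by rewrite ge0_ler_powR ?invr_ge0 ?(ltW v0) ?nnegrE ?powR_ge0 ?fine_ge0.
Qed.

Lemma Lsum_complete (K : R) :
  (forall k, \int[mu]_(x in D) ((\sum_(0 <= i < k) normc (u i x)) `^ v)%:E <= K%:E)%E ->
  (forall e : R, (0 < e)%R -> exists N, forall k,
    \int[mu]_(x in D) ((\sum_(N <= i < k) normc (u i x)) `^ v)%:E <= e%:E)%E ->
  exists g, [/\ Lspace D v%:E g, Lsum D v%:E u g &
    (\int[mu]_(x in D) (normc (g x) `^ v)%:E <= K%:E)%E].
Proof.
move=> AK Ae; pose E := D `&` [set x | (H 0 x < +oo)%E].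
have mE : measurable E by exact: emeasurable_fun_infty_o.
have HE : {ae mu, forall x, D x -> E x}.
  have iH0 : mu.-integrable D (H 0).
    apply/integrableP; split => //; under eq_integral do rewrite gee0_abs//.
    by apply: le_lt_trans (iH AK) _; rewrite ltry.
  have := integrable_ae mD iH0; apply: filterS => x h Dx; split => //=.
  by rewrite -ge0_fin_numE//; exact: h.
pose g x := if x \in E then clim (fun m => \sum_(i < m) u i x) else 0.
have gc x : E x -> ccvg (fun m => \sum_(i < m) u i x) (g x).
  move=> Ex; rewrite /g mem_set//.
  have Sb m : \sum_(i < m) normc (u i x) <= fine (H 0 x) `^ v^-1.
    by have := AH m Ex.2; rewrite /A big_mkord.
  by have [l cl _] := abs_series_ccvg (u := fun i => u i x) Sb; rewrite (climE cl).
have mS m : cmeasurable D (fun x => \sum_(i < m) u i x).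
  by apply: cmeasurable_sum => i; exact: mu_.
have mg : cmeasurable D g.
  split.
    apply: (@measurable_fun_cvg _ _ _ D
        (fun m => (fun x => complex.Re (\sum_(i < m) u i x)) \_ E)) => [m|x Dx].
      apply: (iffLR (measurable_restrict _ mE mD)).
      exact: (measurable_funS mD (@subIsetl _ _ _) (mS m).1).
    have [Ex|Ex] := pselect (E x).
      under eq_cvg do rewrite patchE mem_set//.
      exact: (ccvg_Re (gc x Ex)).
    under eq_cvg do rewrite patchE memNset//.
    by rewrite /g memNset//; exact: cvg_cst.
  apply: (@measurable_fun_cvg _ _ _ D
      (fun m => (fun x => complex.Im (\sum_(i < m) u i x)) \_ E)) => [m|x Dx].
    apply: (iffLR (measurable_restrict _ mE mD)).
    exact: (measurable_funS mD (@subIsetl _ _ _) (mS m).2).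
  have [Ex|Ex] := pselect (E x).
    under eq_cvg do rewrite patchE mem_set//.
    exact: (ccvg_Im (gc x Ex)).
  under eq_cvg do rewrite patchE memNset//.
  by rewrite /g memNset//; exact: cvg_cst.
have Sg m x : E x -> ((normc ((\sum_(i < m) u i x) - g x) `^ v)%:E <= H m x)%E.
  move=> Ex.
  have HmH0 : (H m x <= H 0 x)%E.
    apply: ub_ereal_sup => _ [k _ <-].
    apply: (@le_trans _ _ (A 0 k x `^ v)%:E).
      by rewrite lee_fin ge0_ler_powR ?(ltW v0) ?nnegrE ?Anm.
    by apply: ereal_sup_ubound; exists k.
  have Hm : (H m x < +oo)%E := le_lt_trans HmH0 Ex.2.
  rewrite -[leRHS]fineK ?ge0_fin_numE// lee_fin.
  have -> : fine (H m x) = (fine (H m x) `^ v^-1) `^ v.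
    by rewrite -powRrM mulVf ?gt_eqF// powRr1 ?fine_ge0.
  rewrite ge0_ler_powR ?(ltW v0) ?nnegrE ?normc_ge0 ?powR_ge0//.
  rewrite -[X in normc (_ + X)]mulN1r.
  have gN := ccvgZ (-1) (gc x Ex).
  apply: ccvg_norm_le (ccvgD (ccvg_cst (\sum_(i < m) u i x)) gN).
  exists m => k mk; rewrite mulN1r normcBC.
  apply: le_trans (AH k Hm).
  rewrite -!(big_mkord xpredT (fun i => u i x)) (big_cat_nat (leq0n m) mk)/=.
  by rewrite addrAC subrr add0r normc_sum.
have iSg m (M : R) :
    (forall k, \int[mu]_(x in D) (A m k x `^ v)%:E <= M%:E)%E ->
    (\int[mu]_(x in D) (normc ((\sum_(i < m) u i x) - g x) `^ v)%:E <= M%:E)%E.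
  move=> /iH; apply: le_trans; apply: ae_ge0_le_integral => //.
  - by move=> x _; rewrite lee_fin powR_ge0.
  - by apply: measurable_powR_normc; exact: cmeasurableB.
  - by apply: filterS HE => x DE Dx; apply: Sg; exact: DE.
have ig : (\int[mu]_(x in D) (normc (g x) `^ v)%:E <= K%:E)%E.
  apply: le_trans (iSg 0%N K AK); rewrite le_eqVlt; apply/orP; left; apply/eqP.
  by apply: eq_integral => x _; rewrite big_ord0 sub0r normcN.
exists g; split; last exact: ig.
  by split => //; apply/(cLnorm_lty _ _ v0); apply: le_lt_trans ig _; rewrite ltry.
apply/ecvg0P => [m|e e0]; first exact: cLnorm_ge0.
have e2 : 0 < (e / 2) `^ v by rewrite powR_gt0// divr_gt0.
have [N hN] := Ae _ e2; exists N => m Nm.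
apply: (@le_lt_trans _ _ (e / 2)%:E); last by rewrite lte_fin ltr_pdivrMr// ltr_pMr// ltr1n.
rewrite cLnormE//.
have -> : (e / 2)%:E = (((e / 2) `^ v)%:E `^ v^-1)%E.
  by rewrite poweR_EFin -powRrM divff ?gt_eqF// powRr1// divr_ge0// ltW.
rewrite lee_poweR ?invr_ge0 ?(ltW v0) ?integral_powR_ge0//; apply: iSg => k.
apply: le_trans (hN k); apply: ge0_le_integral => //.
- by move=> x _; rewrite lee_fin powR_ge0.
- exact: (mA N k).
- by move=> x _; rewrite lee_fin ge0_ler_powR ?(ltW v0) ?nnegrE ?sumr_ge0// => [i _|i _|];
    [exact: normc_ge0|exact: normc_ge0|exact: Anm].
Qed.

End Lv_completeness.

(** * The bijection *)

Section bijection.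
Context {R : realType} {n : nat}.
Variables (v : R) (w : \bar R) (c0 : R) (Q0 : cube R n).
Hypotheses (v1 : 1 < v) (vw : (v%:E < w)%E).
Implicit Types (f g h : Rn R n -> R[i]) (s : @atom_series R n).
Implicit Types (S : nat -> @atom_series R n).
Local Notation mu := (lebesgue R n).
Local Notation normc := (@Normc.normc R).
Local Notation jn' := (jn' v w c0 Q0).

Let mQ0 := measurable_cset Q0.
Let v0 : 0 < v := v_gt0 v1.

Lemma powR_sum_disjoint (b : nat -> R) (r : seq nat) : uniq r ->
  (forall i, 0 <= b i) -> (forall i j, b i != 0 -> b j != 0 -> i = j) ->
  (\sum_(i <- r) b i) `^ v <= \sum_(i <- r) b i `^ v.
Proof.
move=> + b0 b1; elim: r => [_|i r ih /= /andP[ir ur]].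
  by rewrite !big_nil powR0// gt_eqF.
rewrite !big_cons; have [bi|bi] := eqVneq (b i) 0.
  by rewrite bi add0r (le_trans (ih ur))// lerDr powR_ge0.
rewrite [X in (_ + X) `^ _]big_seq big1 => [|j jr]; last first.
  by apply/eqP/negPn/negP => /(b1 _ _ bi) ij; rewrite ij jr in ir.
by rewrite addr0 lerDl sumr_ge0// => j _; exact: powR_ge0.
Qed.

Lemma fterm_partial_sum s m k : admissible v w c0 Q0 s ->
  (\int[mu]_(x in cset Q0) ((\sum_(m <= i < k) normc (fterm s i x)) `^ v)%:E <=
   (\sum_(m <= i < k) 2 * normc (coef s i) `^ v)%:E)%E.
Proof.
move=> sad; have [pJ sat s0 _] := sad.
have mf i : cmeasurable (cset Q0) (fterm s i) := (fterm_Lspace v1 vw i sad).1.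
apply: (@le_trans _ _ (\int[mu]_(x in cset Q0)
    \sum_(m <= i < k) ((normc (fterm s i x)) `^ v)%:E)%E).
  apply: ae_ge0_le_integral => //.
  - by move=> x _; rewrite lee_fin powR_ge0.
  - apply/measurable_EFinP.
    apply: (@measurableT_comp _ _ _ _ _ _ (@powR R ^~ v)) => //.
    by apply: measurable_sum => i; exact: measurable_normc.
  - by move=> x _; apply: sume_ge0 => i _; rewrite lee_fin powR_ge0.
  - by apply: emeasurable_sum => i; exact: measurable_powR_normc.
  - apply: filterS (ae_packing_disjoint pJ) => x disj _.
    rewrite sumEFin lee_fin; apply: powR_sum_disjoint.
    + exact: iota_uniq.
    + by move=> i; exact: normc_ge0.
    + have supp i : normc (fterm s i x) != 0 -> idx s i /\ cset (cubes_of s i) x.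
        have [si|si] := pselect (idx s i); last first.
          by rewrite /fterm s0// mul0r Normc.normc0 eqxx.
        move=> h; split=> //; have [_ sp _ _] := sat i si; apply: sp => /=.
        by apply: contra_neq h => h; rewrite /fterm h mulr0 Normc.normc0.
      by move=> i j /supp[si xi] /supp[sj xj]; exact: disj.
rewrite ge0_integral_sum//; last 2 first.
- by move=> i; exact: measurable_powR_normc.
- by move=> i x _; rewrite lee_fin powR_ge0.
rewrite -sumEFin; apply: lee_sum => i _.
by have := fterm_integral_powR v1 vw i sad; exact.
Qed.

Lemma coef_partial_sum s m : (coef_norm v s < +oo)%E ->
  \sum_(i < m) normc (coef s i) `^ v <= fine (coef_norm v s) `^ v.
Proof.
move=> sfin; rewrite -lee_fin -poweR_EFin -coef_norm_fin// /coef_norm.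
rewrite -poweRrM mulVf ?gt_eqF// poweRe1; last first.
  by apply: nneseries_ge0 => j _ _; rewrite lee_fin powR_ge0.
apply: le_trans (nneseries_lim_ge m _); first by rewrite big_mkord sumEFin.
by move=> j _ _; rewrite lee_fin powR_ge0.
Qed.

Lemma fterm_Lsum s : admissible v w c0 Q0 s ->
  exists G, [/\ Lspace (cset Q0) v%:E G, Lsum (cset Q0) v%:E (fterm s) G &
    (cLnorm (cset Q0) v%:E G <= (2 `^ v^-1 * fine (coef_norm v s))%:E)%E].
Proof.
move=> sad; have [_ _ _ sfin] := sad.
pose c := fine (coef_norm v s).
have cge0 : 0 <= c by rewrite fine_ge0// coef_norm_ge0.
have b0 i : 0 <= 2 * normc (coef s i) `^ v by rewrite mulr_ge0// powR_ge0.
have bM m : \sum_(i < m) 2 * normc (coef s i) `^ v <= 2 * c `^ v.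
  by rewrite -mulr_sumr ler_wpM2l// coef_partial_sum.
have [|e e0|G [Gv sG iG]] := @Lsum_complete R n v (cset Q0) (fterm s) v0 mQ0
    (fun i => (fterm_Lspace v1 vw i sad).1) (2 * c `^ v).
- move=> k; apply: le_trans (fterm_partial_sum 0 k sad) _.
  by rewrite lee_fin big_mkord.
- have [N hN] := bounded_series_tail b0 bM e0; exists N => k.
  by apply: le_trans (fterm_partial_sum N k sad) _; rewrite lee_fin ltW// hN.
exists G; split; [exact: Gv|exact: sG|].
rewrite cLnormE// (_ : 2 `^ v^-1 * _ = (2 * c `^ v) `^ v^-1); last first.
  by rewrite powRM ?powR_ge0// -powRrM divff ?gt_eqF// powRr1.
by rewrite -poweR_EFin lee_poweR ?invr_ge0 ?(ltW v0)// integral_powR_ge0.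
Qed.

Lemma cLnorm_sum_normc (G : nat -> Rn R n -> R[i]) (b : nat -> R) m k :
  (forall i, Lspace (cset Q0) v%:E (G i)) ->
  (forall i, cLnorm (cset Q0) v%:E (G i) <= (b i)%:E)%E ->
  (\int[mu]_(x in cset Q0) ((\sum_(m <= i < k) normc (G i x)) `^ v)%:E <=
   ((\sum_(m <= i < k) b i) `^ v)%:E)%E.
Proof.
move=> Gv Gb; pose W r x : R[i] := real_complex R (\sum_(i <- r) normc (G i x)).
have WE r x : normc (W r x) = \sum_(i <- r) normc (G i x).
  by rewrite /W/= expr0n addr0 sqrtr_sqr ger0_norm// sumr_ge0// => i _; exact: normc_ge0.
have mW r : cmeasurable (cset Q0) (W r).
  split => /=; last exact: measurable_cst.
  by apply: measurable_sum => i; apply: measurable_normc; case: (Gv i).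
have Wb r : (cLnorm (cset Q0) v%:E (W r) <= (\sum_(i <- r) b i)%:E)%E.
  elim: r => [|i r ih].
    rewrite big_nil cLnormE//; under eq_integral => x _.
      rewrite WE big_nil powR0 ?gt_eqF//.
      over.
    by rewrite integral0 poweR0r// invr_neq0// gt_eqF.
  have e : W (i :: r) = (fun x => real_complex R (normc (G i x)) + W r x).
    by apply/funext => x; rewrite /W big_cons rmorphD.
  have m1 : cmeasurable (cset Q0) (fun x => real_complex R (normc (G i x))).
    by split => /=; [apply: measurable_normc; case: (Gv i)|exact: measurable_cst].
  rewrite e big_cons EFinD; apply: le_trans (cLnormD mQ0 (ltW v1) m1 (mW r)) _.
  apply: leeD => //; apply: le_trans (Gb i); apply: le_cLnorm => //.
    by case: (Gv i).
  by move=> x _; rewrite /= expr0n addr0 sqrtr_sqr ger0_norm// normc_ge0.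
under eq_integral do rewrite -WE.
by rewrite -cLnorm_poweR// -poweR_EFin lee_poweR ?(ltW v0) ?cLnorm_ge0.
Qed.

Lemma hkhat_exists S : (forall i, admissible v w c0 Q0 (S i)) ->
  (\sum_(i <oo) coef_norm v (S i) < +oo)%E ->
  exists2 g, hkhat v w c0 Q0 g & hkhat_decomp v w c0 Q0 g S.
Proof.
move=> Sad Sfin; have [G Gp] := choice (fun i => fterm_Lsum (Sad i)).
have Gv i : Lspace (cset Q0) v%:E (G i) by have [] := Gp i.
have SG i : Lsum (cset Q0) v%:E (fterm (S i)) (G i) by have [] := Gp i.
pose C := 2 `^ v^-1 : R; have C0 : 0 <= C by exact: powR_ge0.
pose b i := C * fine (coef_norm v (S i)).
have Gb i : (cLnorm (cset Q0) v%:E (G i) <= (b i)%:E)%E by have [] := Gp i.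
have b0 i : 0 <= b i by rewrite mulr_ge0// fine_ge0// coef_norm_ge0.
pose K := C * fine (\sum_(i <oo) coef_norm v (S i))%E.
have bK m : \sum_(i < m) b i <= K by rewrite -mulr_sumr ler_wpM2l// coef_norm_partial_sum.
have K0 : 0 <= K by apply: le_trans (bK 0%N); rewrite big_ord0.
have bge0 m k : 0 <= \sum_(m <= i < k) b i by exact: sumr_ge0.
have [k|e e0|g [gv Gg _]] := @Lsum_complete R n v (cset Q0) G v0 mQ0
    (fun i => (Gv i).1) (K `^ v).
- apply: le_trans (cLnorm_sum_normc 0 k Gv Gb) _.
  by rewrite lee_fin ge0_ler_powR ?(ltW v0) ?nnegrE// big_mkord.
- have e2 : 0 < e `^ v^-1 by rewrite powR_gt0.
  have [N hN] := bounded_series_tail b0 bK e2; exists N => k.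
  apply: le_trans (cLnorm_sum_normc N k Gv Gb) _.
  have -> : e = (e `^ v^-1) `^ v by rewrite -powRrM mulVf ?gt_eqF// powRr1// ltW.
  by rewrite lee_fin ge0_ler_powR ?(ltW v0) ?nnegrE ?powR_ge0// ltW.
have gS : hkhat_decomp v w c0 Q0 g S by split=> //; exists G; split.
by exists g => //; split; [exact: gv|exists S].
Qed.

Lemma hkt_approx phi (e : R) : hkt v w c0 Q0 phi -> 0 < e ->
  exists s, hkt_decomp v w c0 Q0 phi s /\
    (coef_norm v s <= hkt_norm v w c0 Q0 phi + e%:E)%E.
Proof.
move=> [_ [s0 ps0]] e0.
have fin : hkt_norm v w c0 Q0 phi \is a fin_num.
  rewrite ge0_fin_numE ?hkt_norm_ge0//.
  have [[_ _ _ sfin] _] := ps0; apply: le_lt_trans sfin.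
  by apply: ereal_inf_lbound; exists s0.
have [_ [s ps <-] /ltW le] := lb_ereal_inf_adherent e0 fin.
by exists s.
Qed.

Lemma hk_decomp_lift phi T (e : R) : hk_decomp v w c0 Q0 phi T -> 0 < e ->
  exists g S, [/\ hkhat v w c0 Q0 g, hkhat_decomp v w c0 Q0 g S,
    dual_eq v w c0 Q0 (pairing Q0 g) phi &
    (\sum_(i <oo) coef_norm v (S i) <=
     \sum_(i <oo) hkt_norm v w c0 Q0 (T i) + e%:E)%E].
Proof.
move=> [Tk wT Tfin] e0.
have [S Sp] := choice (fun i => hkt_approx (Tk i)
  (divr_gt0 e0 (exprn_gt0 i.+1 (ltr0Sn R 1)))).
have Sad i : admissible v w c0 Q0 (S i) by have [[]] := Sp i.
have Sle : (\sum_(i <oo) coef_norm v (S i) <=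
     \sum_(i <oo) hkt_norm v w c0 Q0 (T i) + e%:E)%E.
  apply: le_trans (epsilon_trick xpredT _ (ltW e0)); last first.
    by move=> i; exact: hkt_norm_ge0.
  apply: lee_nneseries => [i _ _|i _]; first exact: coef_norm_ge0.
  by have [_] := Sp i; rewrite -natrX.
have Sfin : (\sum_(i <oo) coef_norm v (S i) < +oo)%E.
  by apply: le_lt_trans Sle _; rewrite lte_add_pinfty// ltry.
have [g gh gS] := hkhat_exists Sad Sfin.
exists g, S; split=> //.
have [_ wS] := double_functionalP v1 vw Sad Sfin.
have TS i : dual_eq v w c0 Q0 (series_functional (S i)) (T i).
  have [_ ws _] := series_functionalP v1 vw (Sad i).
  by have [[_ wt] _] := Sp i; exact: weak_star_sum_unique ws wt.
move=> f jf; rewrite (pairingE v1 vw gh gS jf).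
move: wT wS => /weak_star_sumP wT /weak_star_sumP wS.
apply: ccvg_unique (wS f jf) _; apply: eq_ccvg (wT f jf) => m.
by apply: eq_bigr => i _; rewrite (TS i f jf).
Qed.

Lemma pairing_indicator g (E : set (Rn R n)) : E `<=` cset Q0 ->
  pairing Q0 g (fun x => if x \in E then 1 else 0) = cint E g.
Proof.
move=> EQ0; apply: climE => e e0; exists 1%N => N N1.
suff -> : cint (cset Q0) (fun x => g x * ctrunc N (if x \in E then 1 else 0)) = cint E g.
  by rewrite subrr Normc.normc0.
have t1 x : ctrunc N (if x \in E then 1 else 0) = (if x \in E then 1 else 0) :> R[i].
  by apply: ctrunc_id; case: ifP => _; rewrite ?Normc.normc0 ?Normc.normc1 ?ler1n.
under eq_cint do rewrite t1.
transitivity (cint E (fun x => g x * (if x \in E then 1 else 0))).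
  apply: cint_restrict => // x; case: ifPn => [/set_mem//|_].
  by rewrite mulr0 eqxx.
by apply: eq_cint => x Ex; rewrite mem_set// mulr1.
Qed.

Lemma jn'_indicator (E : set (Rn R n)) : measurable E ->
  jn' (fun x => if x \in E then 1 else 0).
Proof.
move=> mE; apply: (jn'_bounded c0 v1 vw (M := 1)); last first.
  by move=> x _; case: ifP => _; rewrite ?Normc.normc0 ?Normc.normc1.
split.
  apply: (eq_measurable_fun (\1_E : _ -> R)) => [x _|]; last exact: measurable_indic.
  by rewrite indicE; case: (x \in E).
apply: (eq_measurable_fun (cst 0 : _ -> R)) => [x _|]; last exact: measurable_cst.
by case: (x \in E).
Qed.

Lemma pairing_inj g h : hkhat v w c0 Q0 g -> hkhat v w c0 Q0 h ->
  dual_eq v w c0 Q0 (pairing Q0 g) (pairing Q0 h) -> g = h %[ae mu in cset Q0].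
Proof.
move=> [gv _] [hv _] gh.
have gi := Lspace_cintegrable mQ0 (cset_fin Q0) (ltW v1) gv.
have hi := Lspace_cintegrable mQ0 (cset_fin Q0) (ltW v1) hv.
have ghE (E : set (Rn R n)) : E `<=` cset Q0 -> measurable E -> cint E g = cint E h.
  by move=> EQ mE; rewrite -!pairing_indicator//; apply: gh; exact: jn'_indicator.
have key (F : R[i] -> R) :
    mu.-integrable (cset Q0) (EFin \o (fun x => F (g x))) ->
    mu.-integrable (cset Q0) (EFin \o (fun x => F (h x))) ->
    (forall E, E `<=` cset Q0 -> measurable E ->
       \int[mu]_(x in E) F (g x) = \int[mu]_(x in E) F (h x))%R ->
    {ae mu, forall x, cset Q0 x -> F (g x) = F (h x)}.
  move=> ig ih gh'.
  have ghI E : E `<=` cset Q0 -> measurable E ->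
      (\int[mu]_(x in E) (F (g x))%:E = \int[mu]_(x in E) (F (h x))%:E)%E.
    move=> EQ mE; have gf := integrable_fin_num mE (integrableS mQ0 mE EQ ig).
    have hf := integrable_fin_num mE (integrableS mQ0 mE EQ ih).
    have := congr1 EFin (gh' E EQ mE).
    by rewrite /Rintegral (fineK gf) (fineK hf).
  have := integral_ae_eq mQ0 ig (measurable_int _ ih) ghI.
  by apply: filterS => x e Qx; have [] := e Qx.
have Re_eq := key (@complex.Re R) (cintegrable_Re mQ0 gi) (cintegrable_Re mQ0 hi)
  (fun E EQ mE => congr1 (@complex.Re R) (ghE E EQ mE)).
have Im_eq := key (@complex.Im R) (cintegrable_Im mQ0 gi) (cintegrable_Im mQ0 hi)
  (fun E EQ mE => congr1 (@complex.Im R) (ghE E EQ mE)).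
apply: filterS2 Re_eq Im_eq => x r i Qx; apply/eqP; rewrite eq_complex.
by rewrite r// i// !eqxx.
Qed.

Lemma ae_eq_Lsum (u : nat -> Rn R n -> R[i]) g h :
  (forall i, Lspace (cset Q0) v%:E (u i)) ->
  Lspace (cset Q0) v%:E g -> Lspace (cset Q0) v%:E h ->
  g = h %[ae mu in cset Q0] -> Lsum (cset Q0) v%:E u g -> Lsum (cset Q0) v%:E u h.
Proof.
move=> uv [mg _] [mh _] gh; rewrite /Lsum.
suff e m : cLnorm (cset Q0) v%:E (fun x => (\sum_(i < m) u i x) - g x) =
           cLnorm (cset Q0) v%:E (fun x => (\sum_(i < m) u i x) - h x).
  by under eq_fun do rewrite e.
have mS : cmeasurable (cset Q0) (fun x => \sum_(i < m) u i x).
  by apply: cmeasurable_sum => i; case: (uv i).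
have m1 := measurable_powR_normc v (cmeasurableB mS mg).
have m2 := measurable_powR_normc v (cmeasurableB mS mh).
rewrite !cLnormE//; congr (_ `^ _)%E; apply: (ae_eq_integral _ _ mQ0 m1 m2).
by apply: filterS gh => x e Qx; rewrite e.
Qed.

Lemma hkhat_norm_le_hk_norm g : hkhat v w c0 Q0 g ->
  (hkhat_norm v w c0 Q0 g <= hk_norm v w c0 Q0 (pairing Q0 g))%E.
Proof.
move=> gh; apply: le_ereal_inf_tmp => _ [T gT <-].
apply/lee_addgt0Pr => e e0.
have [g' [S [g'h [Sad Sfin [G [Gv SG Gg']]] g'g le]]] := hk_decomp_lift gT e0.
apply: le_trans le; apply: ereal_inf_lbound; exists S => //.
split=> //; exists G; split=> //.
exact: ae_eq_Lsum Gv g'h.1 gh.1 (pairing_inj g'h gh g'g) Gg'.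
Qed.

End bijection.

Unset Implicit Arguments.

Theorem proposition4p14 (R : realType) (n : nat) (hn : (0 < n)%N)
    (v : R) (hv : 1 < v) (w : \bar R) (hw : (v%:E < w)%E)
    (Q0 : cube R n) (c0 : R) (hc0 : 0 < c0) (hc0Q0 : c0 < side Q0) :
  exists Phi : (Rn R n -> R[i]) -> ((Rn R n -> R[i]) -> R[i]),
    [/\ (* Phi g is the iterated weak-* sum of every decomposition of g *)
        (forall g S, hkhat v w c0 Q0 g -> hkhat_decomp v w c0 Q0 g S ->
           dual_double_sum v w c0 Q0 S (Phi g)),
        (* well defined on, and injective on, classes modulo a.e. equality *)
        (forall g h, hkhat v w c0 Q0 g -> hkhat v w c0 Q0 h ->
           (g = h %[ae lebesgue R n in cset Q0] <->
            dual_eq v w c0 Q0 (Phi g) (Phi h))),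
        (forall g, hkhat v w c0 Q0 g -> hk v w c0 Q0 (Phi g)),
        (forall phi, hk v w c0 Q0 phi ->
           exists2 g, hkhat v w c0 Q0 g & dual_eq v w c0 Q0 (Phi g) phi)
      & exists c C : R, [/\ 0 < c, 0 < C &
          forall g, hkhat v w c0 Q0 g ->
            (c%:E * hkhat_norm v w c0 Q0 g <= hk_norm v w c0 Q0 (Phi g))%E /\
            (hk_norm v w c0 Q0 (Phi g) <= C%:E * hkhat_norm v w c0 Q0 g)%E]].
Proof.
exists (pairing Q0); split.
- by move=> g S; exact: dual_double_sum_pairing.
- move=> g h gh hh; split; first exact: eq_ae_pairing.
  exact: pairing_inj.
- by move=> g; exact: hk_pairing.
- move=> phi [_ [T phiT]].
  have [g [S [gh _ gphi _]]] := hk_decomp_lift hv hw phiT ltr01.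
  by exists g.
- exists 1, 1; split=> // g gh; rewrite !mul1e.
  by split; [exact: hkhat_norm_le_hk_norm|exact: hk_norm_pairing_le].
Qed.
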